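(* The topological radical $\mathcal{R}_{\mathrm{hc}}\vee\mathcal{R}_{\mathrm{cq}}$ is hereditary, i.e. $(\mathcal{R}_{\mathrm{hc}}\vee\mathcal{R}_{\mathrm{cq}})(J)=J\cap(\mathcal{R}_{\mathrm{hc}}\vee\mathcal{R}_{\mathrm{cq}})(A)$ for every Banach algebra $A$ and every closed ideal $J$ of $A$.
   Context: For a bounded subset $M$ of a Banach algebra, $\rho(M)=\lim_n\|M^n\|^{1/n}$ where $\|M\|=\sup_{a\in M}\|a\|$ and $M^n=\{a_1\cdots a_n:a_i\in M\}$. A Banach algebra is compactly quasinilpotent if $\rho(M)=0$ for every precompact $M$. An element $a$ is compact if $x\mapsto axa$ is a compact operator; an algebra is hypocompact if every non-zero quotient by a closed ideal has a non-zero compact element. A topological radical is a map $\mathcal{P}$ assigning to each Banach algebra $A$ a closed two-sided ideal $\mathcal{P}(A)$ such that: $f(\mathcal{P}(A))\subseteq\mathcal{P}(B)$ for continuous surjective homomorphisms $f:A\to B$; $\mathcal{P}(A/\mathcal{P}(A))=0$; $\mathcal{P}(\mathcal{P}(A))=\mathcal{P}(A)$; and for each closed ideal $J$ of $A$, $\mathcal{P}(J)$ is an ideal of $A$ contained in $\mathcal{P}(A)$. $\mathcal{P}\vee\mathcal{R}$ is the smallest topological radical containing both ($\mathcal{P}\le\mathcal{R}$ meaning $\mathcal{P}(A)\subseteq\mathcal{R}(A)$ for all $A$). $\mathcal{R}_{\mathrm{hc}}(A)$ and $\mathcal{R}_{\mathrm{cq}}(A)$ denote the largest hypocompact and largest compactly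 quasinilpotent closed ideals of $A$. *)

(* Defs.v *)
From HB Require Import structures.
From mathcomp Require Import all_boot all_order all_algebra.
From mathcomp Require Import all_classical all_reals all_analysis.
From mathcomp Require Export complex.
Import numFieldNormedType.Exports.
Import Order.TTheory GRing.Theory Num.Theory.

Set Implicit Arguments.
Unset Strict Implicit.
Unset Printing Implicit Defensive.

Local Open Scope classical_set_scope.
Local Open Scope ring_scope.

Record banach_algebra (R : realType) : Type := BanachAlgebra {
  ba_sort :> completeNormedModType R[i];
  ba_mul : ba_sort -> ba_sort -> ba_sort;
  ba_mulA : forall a b c, ba_mul a (ba_mul b c) = ba_mul (ba_mul a b) c;
  ba_mulDl : forall a b c, ba_mul (a + b) c = ba_mul a c + ba_mul b c;
  ba_mulDr : forall a b c, ba_mul a (b + c) = ba_mul a b + ba_mul a c;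
  ba_mulZl : forall (t : R[i]) a b, ba_mul (t *: a) b = t *: ba_mul a b;
  ba_mulZr : forall (t : R[i]) a b, ba_mul a (t *: b) = t *: ba_mul a b;
  ba_normM : forall a b, `|ba_mul a b| <= `|a| * `|b|
}.

Arguments ba_mul {R} _ _ _.

Section BanachAlgebraNotions.
Variable R : realType.

Definition is_subspace (A : banach_algebra R) (S : set A) : Prop :=
  S 0 /\ (forall x y, S x -> S y -> S (x + y)) /\
  (forall (t : R[i]) x, S x -> S (t *: x)).

Definition ideal_in (A : banach_algebra R) (I K : set A) : Prop :=
  K `<=` I /\ is_subspace K /\
  (forall a x, I a -> K x -> K (ba_mul A a x) /\ K (ba_mul A x a)).

Definition closed_ideal (A : banach_algebra R) (J : set A) : Prop :=
  ideal_in setT J /\ closed J.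

Definition closed_ideal_in (A : banach_algebra R) (I K : set A) : Prop :=
  ideal_in I K /\ closed K.

Definition is_hom (A B : banach_algebra R) (f : A -> B) : Prop :=
  (forall x y, f (x + y) = f x + f y) /\
  (forall (t : R[i]) x, f (t *: x) = t *: f x) /\
  (forall x y, f (ba_mul A x y) = ba_mul B (f x) (f y)).

(* i : C -> A is an isometric isomorphism of C onto J (with the norm of A):
   C is "the Banach algebra J" *)
Definition embeds_onto (C A : banach_algebra R) (i : C -> A) (J : set A)
  : Prop :=
  is_hom i /\ (forall x, `|i x| = `|x|) /\ range i = J.

(* q : A -> B identifies B with the quotient Banach algebra A / K:
   surjective homomorphism with kernel K and  |q x| = inf_{k in K} |x - k| *)
Definition quotient_map (A B : banach_algebra R) (q : A -> B) (K : set A)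
  : Prop :=
  is_hom q /\ (forall y, exists x, q x = y) /\
  (forall x, q x = 0 <-> K x) /\
  (forall x k, K k -> `|q x| <= `|x - k|) /\
  (forall x (e : R[i]), 0 < e -> exists2 k, K k & `|x - k| < `|q x| + e).

Definition radical_map := forall A : banach_algebra R, set A.

Definition topological_radical (P : radical_map) : Prop :=
  (forall A, closed_ideal (P A)) /\
  (forall (A B : banach_algebra R) (f : A -> B),
      is_hom f -> continuous f -> (forall y, exists x, f x = y) ->
      f @` P A `<=` P B) /\
  (forall (A B : banach_algebra R) (q : A -> B),
      quotient_map q (P A) -> P B = [set 0]) /\
  (forall (A C : banach_algebra R) (i : C -> A),
      embeds_onto i (P A) -> i @` P C = P A) /\
  (forall (A C : banach_algebra R) (J : set A) (i : C -> A),
      closed_ideal J -> embeds_onto i J ->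
      ideal_in setT (i @` P C) /\ i @` P C `<=` P A).

Definition radical_le (P Q : radical_map) : Prop := forall A, P A `<=` Q A.

Definition is_radical_join (P Q T : radical_map) : Prop :=
  topological_radical T /\ radical_le P T /\ radical_le Q T /\
  (forall T', topological_radical T' -> radical_le P T' -> radical_le Q T' ->
     radical_le T T').

Definition hereditary (P : radical_map) : Prop :=
  forall (A C : banach_algebra R) (J : set A) (i : C -> A),
    closed_ideal J -> embeds_onto i J -> i @` P C = J `&` P A.

(* S is totally bounded (= precompact, since the spaces are complete)
   in the quotient I/K, i.e. for the quotient seminorm x |-> inf_{k in K}|x-k| *)
Definition precompact_mod (A : banach_algebra R) (I K S : set A) : Prop :=
  forall e : R[i], 0 < e -> exists F : seq A,
    (forall f, f \in F -> I f) /\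
    forall y, S y -> exists f, f \in F /\ exists2 k, K k & `|y - f - k| < e.

(* a + K is a compact element of the Banach algebra I / K:
   x + K |-> a x a + K maps the open unit ball of I/K to a precompact set *)
Definition compact_elt_mod (A : banach_algebra R) (I K : set A) (a : A) : Prop :=
  I a /\ precompact_mod I K
    [set ba_mul A (ba_mul A a x) a | x in
       [set x | I x /\ exists2 k, K k & `|x - k| < 1]].

Definition hypocompact_ideal (A : banach_algebra R) (I : set A) : Prop :=
  forall K, closed_ideal_in I K -> (exists x, I x /\ ~ K x) ->
    exists a, I a /\ ~ K a /\ compact_elt_mod I K a.

Definition ba_prod (A : banach_algebra R) (a : A) (s : seq A) : A :=
  foldl (ba_mul A) a s.

(* rho(M) = lim_n ||M^n||^(1/n) = 0, written out:
   for every e > 0, eventually ||M^n|| <= e^n *)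
Definition joint_spectral_radius_zero (A : banach_algebra R) (M : set A)
  : Prop :=
  forall e : R[i], 0 < e -> exists N : nat, forall n : nat, (N <= n)%N ->
    forall (a : A) (s : seq A), size s = n -> M a ->
      (forall x, x \in s -> M x) -> `|ba_prod a s| <= e ^+ n.+1.

Definition compactly_quasinilpotent_ideal (A : banach_algebra R) (I : set A)
  : Prop :=
  forall M : set A, M `<=` I -> precompact_mod setT (fun x => x = 0) M ->
    joint_spectral_radius_zero M.

Definition is_Rhc (P : radical_map) : Prop :=
  forall A : banach_algebra R,
    closed_ideal (P A) /\ hypocompact_ideal (P A) /\
    (forall I, closed_ideal I -> hypocompact_ideal I -> I `<=` P A).

Definition is_Rcq (P : radical_map) : Prop :=
  forall A : banach_algebra R,
    closed_ideal (P A) /\ compactly_quasinilpotent_ideal (P A) /\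
    (forall I, closed_ideal I -> compactly_quasinilpotent_ideal I ->
       I `<=` P A).

End BanachAlgebraNotions.

(* Main.v *)
Require Import Defs.
From HB Require Import structures.
From mathcomp Require Import all_boot all_order all_algebra.
From mathcomp Require Import all_classical all_reals all_analysis.
From mathcomp Require Import complex.
From mathcomp Require Import ring lra.
Import numFieldNormedType.Exports.
Import Order.TTheory GRing.Theory Num.Theory.

(** Call B semisimple if it has no non-zero compact element and no non-zero
    closed compactly quasinilpotent ideal, and let S(A) be the intersection of
    the kernels of all continuous surjections of A onto semisimple algebras.
    S is a topological radical above R_hc and R_cq, hence above T.  Two facts
    drive everything.  Semisimplicity passes to algebras D with an injection
    D -> B onto an ideal of B: from a compact a in D one gets compact elements
    d a d' of B, and from a compactly quasinilpotent ideal I of D the ideal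
    {x | D x D <= I} of B, whose closure is again compactly quasinilpotent.
    Conversely, if f : J -> B is a surjection of a closed ideal J of A onto a
    semisimple B, then A / {x | f(J x J) = 0} is semisimple and restricts to an
    injection of B, so a non-zero B is impossible when S(A) = A.
    Now let K = J n T(A) and B = K / T(K).  As T(B) = 0, B is semisimple; as K
    is an ideal of T(A), on which T and therefore S is everything, B = 0.  So
    T(K) = K, and K <= T(J) because K is an ideal of J. *)

Set Implicit Arguments.
Unset Strict Implicit.
Unset Printing Implicit Defensive.

Local Open Scope classical_set_scope.
Local Open Scope ring_scope.

(** [T] is given only by minimality, so membership in [T A] has no internal description, and a bound
    from above must come from another topological radical; this is what S is for. Two obstacles
    shape the rest. An ideal of an ideal need not be an ideal, and there is no approximate identity
    to help. Sandwiches d x d' replace it: an element of the larger algebra acting on x slides onto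
    d or d', so sets defined by sandwiches are stable under the larger algebra. They lose nothing,
    since the elements b with B b B = 0 form an ideal of cube 0, which a semisimple algebra
    excludes. Secondly, the injections have neither closed range nor equivalent norms: the algebra
    inside may carry a finer norm, in which the action of the outer one is bounded thanks to the
    open mapping theorem. Hence the work on closures, where quasinilpotence has to be carried from a
    dense ideal with a finer norm to its closure. *)

Local Notation "x ** y" := (ba_mul _ x y) (at level 40, left associativity).

(** * The norm as a real number *)

Section RealNorm.
Variable R : realType.
Implicit Types V W : normedModType R[i].

Definition rn V (x : V) : R := complex.Re `|x|.

Lemma normE V (x : V) : `|x| = (rn x)%:C%C.
Proof. by rewrite /rn RRe_real // normr_real. Qed.

Lemma gt0_realE (e : R[i]) : 0 < e -> exists2 r : R, 0 < r & e = r%:C%C.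
Proof.
move=> e0; have re : e = (complex.Re e)%:C%C by rewrite RRe_real ?gtr0_real.
by by exists (complex.Re e); rewrite // -ltcR -re.
Qed.

Lemma rn_ge0 V (x : V) : 0 <= rn x.
Proof. by rewrite -ler0c -normE. Qed.
Hint Extern 0 (is_true (Order.le _ (rn _))) => solve [apply: rn_ge0] : core.

Lemma rn0 V : rn (0 : V) = 0.
Proof. by rewrite /rn normr0. Qed.

Lemma rn0_eq0 V (x : V) : rn x = 0 -> x = 0.
Proof. by move=> x0; apply/eqP; rewrite -normr_eq0 normE x0. Qed.

Lemma rn_le0 V (x : V) : (forall e : R, 0 < e -> rn x <= e) -> x = 0.
Proof.
move=> h; apply: rn0_eq0; apply/eqP; rewrite eq_le rn_ge0 andbT.
by apply/ler_addgt0Pl => e e0; rewrite addr0 h.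
Qed.

Lemma rnD V (x y : V) : rn (x + y) <= rn x + rn y.
Proof. by rewrite -lecR rmorphD /= -!normE ler_normD. Qed.

Lemma rnN V (x : V) : rn (- x) = rn x.
Proof. by rewrite /rn normrN. Qed.

Lemma rnBC V (x y : V) : rn (x - y) = rn (y - x).
Proof. by rewrite -rnN opprB. Qed.

Lemma rnB V (x y : V) : rn (x - y) <= rn x + rn y.
Proof. by rewrite (le_trans (rnD _ _)) // rnN. Qed.

Lemma rn_triangle V (z x y : V) : rn (x - y) <= rn (x - z) + rn (z - y).
Proof. by rewrite (le_trans _ (rnD _ _)) // addrA subrK. Qed.

Lemma rn_dist V (x y : V) : rn x <= rn y + rn (x - y).
Proof. by have := rnD y (x - y); rewrite addrC subrK. Qed.

Lemma rnZ V (t : R[i]) (x : V) : rn (t *: x) = complex.Re `|t| * rn x.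
Proof.
by apply: complexI; rewrite rmorphM /= -!normE normrZ.
Qed.

Lemma rnZr V (t : R) (x : V) : 0 <= t -> rn (t%:C%C *: x) = t * rn x.
Proof. by move=> t0; rewrite rnZ ger0_norm ?ler0c. Qed.

Lemma norm_lt V (x : V) (r : R) : (`|x| < r%:C%C) = (rn x < r).
Proof. by rewrite normE ltcR. Qed.

Lemma norm_le V (x : V) (r : R) : (`|x| <= r%:C%C) = (rn x <= r).
Proof. by rewrite normE lecR. Qed.

Lemma rn_nbhs V (x : V) (U : set V) :
  nbhs x U <-> exists2 e : R, 0 < e & forall y, rn (x - y) < e -> U y.
Proof.
split.
  move/nbhs_ballP => [e /= /gt0_realE[r r0 ->] h]; exists r => // y xy.
  by apply: h; rewrite -ball_normE /= norm_lt.
move=> [r r0 h]; apply/nbhs_ballP; exists r%:C%C => /=; first by rewrite ltcR.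
by move=> y; rewrite -ball_normE /= norm_lt => /h.
Qed.

Lemma closed_rnP V (J : set V) :
  closed J <-> forall x, (forall e : R, 0 < e -> exists2 y, J y & rn (x - y) < e) ->
                         J x.
Proof.
split=> [cJ x h|h x cx].
  apply: cJ => U /rn_nbhs[e e0 eU]; have [y Jy xy] := h _ e0.
  by exists y; split=> //; apply: eU.
apply: h => e e0; have [] := cx [set y | rn (x - y) < e].
  by apply/rn_nbhs; exists e.
by move=> y [Jy xy]; exists y.
Qed.

(** The bound is the exact partial sum of the geometric series, so that the induction on [k] closes;
    the cruder [2 * c * 2^-1 ^+ n] would not reproduce itself. *)
Lemma rcauchy_tail V (u : nat -> V) (c : R) :
  (forall n, rn (u n.+1 - u n) <= c * 2^-1 ^+ n) ->
  forall n k, rn (u (n + k)%N - u n) <= 2 * c * (2^-1 ^+ n - 2^-1 ^+ (n + k)).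
Proof.
move=> h n; elim=> [|k IH]; first by rewrite addn0 !subrr rn0 mulr0.
rewrite addnS (le_trans (rn_triangle (u (n + k)%N) _ _)) //.
rewrite (le_trans (lerD (h _) IH)) // exprSr.
by rewrite le_eqVlt; apply/orP; left; apply/eqP; field.
Qed.

Lemma half_exp_lt (c e : R) : 0 < e -> exists n, c * 2^-1 ^+ n < e.
Proof.
move=> e0; have [n hn] : exists n : nat, c / e < n%:R.
  have [c0|c0] := leP (c / e) 0; first by exists 1%N; rewrite (le_lt_trans c0).
  exists (Num.truncn (c / e)).+1; exact: truncnS_gt.
exists n; rewrite exprVn ltr_pdivrMr ?exprn_gt0 // mulrC -ltr_pdivrMr //.
by rewrite (lt_le_trans hn) // -natrX ler_nat ltnW // ltn_expl.
Qed.

Lemma half_exp_small (e : R) : 0 < e -> exists n, 2^-1 ^+ n < e.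
Proof. by move=> /(half_exp_lt 1)[n]; rewrite mul1r; exists n. Qed.

Lemma half_exp_le (n m : nat) : (n <= m)%N -> 2^-1 ^+ m <= 2^-1 ^+ n :> R.
Proof.
by move=> nm; rewrite !exprVn lef_pV2 ?posrE ?exprn_gt0 // ler_eXn2l ?ltr1n.
Qed.

Lemma rcauchy_cvg (V : completeNormedModType R[i]) (u : nat -> V) (c : R) :
  (forall n, rn (u n.+1 - u n) <= c * 2^-1 ^+ n) ->
  exists l, forall n, rn (l - u n) <= 2 * c * 2^-1 ^+ n.
Proof.
move=> h; have tail := rcauchy_tail h.
have c0 : 0 <= c by have := h 0%N; rewrite expr0 mulr1; apply: le_trans.
have tail' n k : (n <= k)%N -> rn (u k - u n) <= 2 * c * 2^-1 ^+ n.
  move=> /subnKC <-; rewrite (le_trans (tail _ _)) // ler_wpM2l ?mulr_ge0 //.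
  by rewrite gerBl exprn_ge0.
have : cauchy (u @ \oo).
  apply/cauchy_exP => e /= /gt0_realE[r r0 ->].
  have [n hn] := half_exp_lt (2 * c) r0.
  exists (u n); exists n => // m /= nm; rewrite -ball_normE /= norm_lt rnBC.
  exact: le_lt_trans (tail' _ _ nm) hn.
move=> /cauchy_cvg /cvg_ex[l /= hl]; exists l => n.
apply/ler_addgt0Pl => e e0.
have /hl [k _ hk] : nbhs l [set y | rn (l - y) < e] by apply/rn_nbhs; exists e.
have := hk (maxn k n) (leq_maxl _ _) => /= lk.
rewrite (le_trans (rn_triangle (u (maxn k n)) _ _)) //.
by rewrite lerD ?(ltW lk) // tail' ?leq_maxr.
Qed.

(** Completeness is stated for filters, while the algebras built below are complete along sequences
    of geometric rate. Centres of balls of radius [2^-1 ^+ n] that belong to the filter form such a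
    sequence, as consecutive balls meet. *)
Lemma seq_complete V :
  (forall u : nat -> V, (forall n, rn (u n.+1 - u n) <= 2 * 2^-1 ^+ n) ->
     exists l, forall e : R, 0 < e -> exists n0, forall n, (n0 <= n)%N -> rn (l - u n) < e) ->
  forall (F : set_system V), ProperFilter F -> cauchy F -> cvg F.
Proof.
move=> h F FF /cauchyP hF.
have ex n : exists x : V, F [set y | rn (x - y) < 2^-1 ^+ n].
  have [|x hx] := hF ((2^-1 ^+ n : R)%:C%C).
    by rewrite ltcR exprn_gt0.
  exists x; apply: filterS hx => y; rewrite -ball_normE /= norm_lt //.
have {ex} [u hu] := choice ex.
have [n|l hl] := h u.
  have /filter_ex[y [/= y1 y2]] : F ([set y | rn (u n - y) < 2^-1 ^+ n] `&`
      [set y | rn (u n.+1 - y) < 2^-1 ^+ n.+1]) by apply: filterI; apply: hu.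
  rewrite (le_trans (rn_triangle y _ _)) // [X in _ + X]rnBC.
  have := half_exp_le (leqnSn n); lra.
apply/cvg_ex; exists l => U /rn_nbhs[e e0 eU].
have e20 : 0 < e / 2 by rewrite divr_gt0.
have [n1 hn1] := hl _ e20; have [n2 hn2] := half_exp_small e20.
pose n := maxn n1 n2; apply: filterS (hu n) => y /= hy; apply: eU.
have := hn1 n (leq_maxl _ _); have := half_exp_le (leq_maxr n1 n2).
rewrite -/n => a b; have := rn_triangle (u n) l y; lra.
Qed.

End RealNorm.
#[export] Hint Extern 0 (is_true (Order.le _ (rn _))) => solve [apply: rn_ge0] : core.

(** * Totally bounded sets *)

Section TotallyBounded.
Variable R : realType.
Implicit Types V W : normedModType R[i].

(* Total boundedness, by finite colourings with classes of small diameter. *)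
Definition tot_bounded V (S : set V) := forall e : R, 0 < e ->
  exists (T : finType) (col : V -> T),
    forall x y, S x -> S y -> col x = col y -> rn (x - y) < e.

(** One point of [S] is kept for each colour that occurs in [S]; the net thus lies in [S], and its
    points inherit the properties of [S]. *)
Lemma tot_bounded_net V (S : set V) : tot_bounded S -> forall e : R, 0 < e -> exists F : seq V,
  (forall f, f \in F -> S f) /\ forall y, S y -> exists2 f, f \in F & rn (y - f) < e.
Proof.
move=> pS e /pS[T [col hcol]].
have ex t : exists pk : option V, (forall x, pk = Some x -> S x /\ col x = t) /\
    (forall y, S y -> col y = t -> exists x, pk = Some x).
  have [[x [Sx xt]]|nx] := pselect (exists x, S x /\ col x = t).
    exists (Some x); split=> [_ [<-] //|y Sy yt]; by exists x.
  by exists None; split=> // y Sy yt; case: nx; exists y.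
have [pk hpk] := choice ex.
exists (pmap pk (enum T)); split.
  move=> f; rewrite mem_pmap => /mapP[t _ /esym ot].
  by case: (hpk t) => /(_ _ ot)[].
move=> y Sy; case: (hpk (col y)) => h1 /(_ y Sy erefl)[x ox].
case: (h1 _ ox) => Sx xy.
exists x; last by apply: hcol.
by rewrite mem_pmap; apply/mapP; exists (col y); rewrite ?mem_enum.
Qed.

Lemma net_tot_bounded V (S : set V) : (forall e : R, 0 < e -> exists F : seq V,
  forall y, S y -> exists2 f, f \in F & rn (y - f) < e) -> tot_bounded S.
Proof.
move=> h e e0; have e20 : 0 < e / 2 by rewrite divr_gt0.
have [F hF] := h _ e20.
(* The colour is the index of a nearby net point. The successor keeps the colour type inhabited, for
   points outside [S]. *)
have ex y : exists i : 'I_(size F).+1, S y -> rn (y - nth 0 F i) < e / 2.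
  have [Sy|] := pselect (S y); last by exists ord0.
  have [f fF yf] := hF y Sy.
  have lt : (index f F < (size F).+1)%N by rewrite ltnS index_size.
  by exists (Ordinal lt) => _ /=; rewrite nth_index.
have [col hcol] := choice ex.
exists ('I_(size F).+1 : finType), col => x y Sx Sy xy.
have := hcol x Sx; have := hcol y Sy; rewrite -xy rnBC => a b.
have := rn_triangle (nth 0 F (col x)) x y; lra.
Qed.

(** A relation instead of a map, because images used later are defined implicitly, as the [y] with
    [g y] equal to a given product. Each [y] is coloured by the pair of colours of one chosen
    source. *)
Lemma tot_bounded_map2 V1 V2 V (S1 : set V1) (S2 : set V2) (S : set V)
    (r : V1 -> V2 -> V -> Prop) (C : R) :
  tot_bounded S1 -> tot_bounded S2 ->
  (forall y, S y -> exists x1 x2, [/\ S1 x1, S2 x2 & r x1 x2 y]) ->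
  (forall x1 x2 y x1' x2' y', S1 x1 -> S2 x2 -> S1 x1' -> S2 x2' ->
    r x1 x2 y -> r x1' x2' y' -> rn (y - y') <= C * (rn (x1 - x1') + rn (x2 - x2'))) ->
  tot_bounded S.
Proof.
move=> p1 p2 hS hr e e0.
have C0 : 0 < `|C| + 1 by rewrite ltr_pwDr.
have d0 : 0 < e / (2 * (`|C| + 1)) by rewrite divr_gt0 // mulr_gt0.
have [T1 [col1 h1]] := p1 _ d0; have [T2 [col2 h2]] := p2 _ d0.
have ex y : exists x : V1 * V2, S y -> [/\ S1 x.1, S2 x.2 & r x.1 x.2 y].
  have [Sy|] := pselect (S y); last by exists (0, 0).
  by have [x1 [x2 ?]] := hS y Sy; exists (x1, x2).
have [c hc] := choice ex.
exists (T1 * T2)%type, (fun y => (col1 (c y).1, col2 (c y).2)).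
move=> x y /hc[x1 x2 rx] /hc[y1 y2 ry] [/(h1 _ _ x1 y1) a /(h2 _ _ x2 y2) b].
rewrite (le_lt_trans (hr _ _ _ _ _ _ x1 x2 y1 y2 rx ry)) //.
rewrite (@le_lt_trans _ _ ((`|C| + 1) * (rn ((c x).1 - (c y).1) + rn ((c x).2 - (c y).2)))) //.
  by apply: ler_wpM2r; [exact: addr_ge0|have := ler_norm C; lra].
rewrite mulrC -ltr_pdivlMr //.
apply: lt_le_trans (ltrD a b) _.
rewrite le_eqVlt; apply/orP; left; apply/eqP; field.
by apply: lt0r_neq0.
Qed.

Lemma tot_bounded_map V1 V (S1 : set V1) (S : set V) (r : V1 -> V -> Prop) (C : R) :
  tot_bounded S1 -> (forall y, S y -> exists2 x, S1 x & r x y) ->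
  (forall x y x' y', S1 x -> S1 x' -> r x y -> r x' y' -> rn (y - y') <= C * rn (x - x')) ->
  tot_bounded S.
Proof.
move=> p1 hS hr; apply: (@tot_bounded_map2 _ _ _ S1 [set (0 : V1)] S (fun x _ y => r x y) C) => //.
- by move=> e e0; exists unit, (fun=> tt) => x y -> ->; rewrite subrr rn0.
- by move=> y /hS[x Sx rxy]; exists x, 0.
- move=> x1 x2 y x1' x2' y' ? -> ? -> h1 h2.
  by rewrite subrr rn0 addr0 hr.
Qed.

Lemma tot_bounded_sub V (S S' : set V) : S' `<=` S -> tot_bounded S -> tot_bounded S'.
Proof. by move=> s h e /h[T [col hc]]; exists T, col => x y /s ? /s ?; apply: hc. Qed.

Lemma tot_boundedU V (S S' : set V) : tot_bounded S -> tot_bounded S' -> tot_bounded (S `|` S').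
Proof.
move=> h h'; apply: net_tot_bounded => e e0.
have [F [_ hF]] := tot_bounded_net h e0; have [F' [_ hF']] := tot_bounded_net h' e0.
exists (F ++ F') => y [/hF|/hF'] [f fF yf]; exists f => //; rewrite mem_cat fF ?orbT //.
Qed.

Lemma tot_bounded_seq V (F : seq V) : tot_bounded [set x | x \in F].
Proof. by apply: net_tot_bounded => e e0; exists F => y yF; exists y => //; rewrite subrr rn0. Qed.

Lemma tot_bounded_bounded V (S : set V) : tot_bounded S -> exists2 m : R, 0 < m & forall x, S x -> rn x <= m.
Proof.
move=> /tot_bounded_net/(_ 1 ltr01)[F [_ hF]].
exists (1 + \sum_(f <- F) rn f); first by rewrite ltr_pwDl // sumr_ge0.
move=> x /hF[f fF xf]; rewrite (le_trans (rn_dist _ f)) // addrC lerD ?(ltW xf) //.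
by rewrite (big_rem f) //= lerDl sumr_ge0.
Qed.

(** Pieces of large index lie in a small ball about 0, so the single point 0 serves them all and
    finitely many pieces remain. *)
Lemma tot_bounded_bigU V (H : nat -> set V) (m : R) :
  (forall k, tot_bounded (H k)) -> (forall k x, H k x -> rn x <= m * 2^-1 ^+ k) ->
  tot_bounded [set x | exists k, H k x].
Proof.
move=> pH hm; apply: net_tot_bounded => e e0; have [n hn] := half_exp_lt `|m| e0.
have pn : tot_bounded [set x | exists2 k, (k < n)%N & H k x].
  elim: (n) => [|k IH]; first by apply: (@tot_bounded_sub _ [set x | x \in [::]]) (@tot_bounded_seq _ _) => x [].
  apply: (tot_bounded_sub _ (tot_boundedU IH (pH k))) => x [j]; rewrite ltnS leq_eqVlt => /orP[/eqP->|jk] Hx.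
    by right.
  by left; exists j.
have [F [_ hF]] := tot_bounded_net pn e0.
exists (0 :: F) => y [k Hy]; have [kn|nk] := ltnP k n.
  by have [|f fF yf] := hF y; [exists k|exists f; rewrite // inE fF orbT].
exists 0; rewrite ?inE ?eqxx // subr0 (le_lt_trans (hm _ _ Hy)) //.
rewrite (le_lt_trans _ hn) // (le_trans (ler_wpM2r _ (ler_norm m))) ?exprn_ge0 //.
by rewrite ler_wpM2l // half_exp_le.
Qed.

End TotallyBounded.

(** * Products, homomorphisms and quasinilpotent sets *)

Section Algebra.
Variable R : realType.
Implicit Types A B D : banach_algebra R.

Lemma rnM A (x y : A) : rn (x ** y) <= rn x * rn y.
Proof. by rewrite -lecR rmorphM /= -!normE ba_normM. Qed.

Lemma ba_mul0l A (x : A) : 0 ** x = 0.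
Proof. by rewrite -[X in X ** _](scale0r (0 : A)) ba_mulZl scale0r. Qed.

Lemma ba_mul0r A (x : A) : x ** 0 = 0.
Proof. by rewrite -[X in _ ** X](scale0r (0 : A)) ba_mulZr scale0r. Qed.

Lemma ba_mulNl A (x y : A) : (- x) ** y = - (x ** y).
Proof. by rewrite -scaleN1r ba_mulZl scaleN1r. Qed.

Lemma ba_mulNr A (x y : A) : x ** (- y) = - (x ** y).
Proof. by rewrite -scaleN1r ba_mulZr scaleN1r. Qed.

Lemma ba_mulBl A (x y z : A) : (x - y) ** z = x ** z - y ** z.
Proof. by rewrite ba_mulDl ba_mulNl. Qed.

Lemma ba_mulBr A (x y z : A) : x ** (y - z) = x ** y - x ** z.
Proof. by rewrite ba_mulDr ba_mulNr. Qed.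

Lemma foldl_mulA A (u a : A) s :
  foldl (ba_mul A) (u ** a) s = u ** foldl (ba_mul A) a s.
Proof. by elim: s a => //= b s IH a; rewrite -ba_mulA IH. Qed.

Lemma foldl_bound A (u : A) (m : R) s :
  0 <= m -> (forall x, x \in s -> rn x <= m) ->
  rn (foldl (ba_mul A) u s) <= m ^+ size s * rn u.
Proof.
move=> m0; elim: s u => [|b s IH] u h /=; first by rewrite mul1r.
have -> : (m ^+ (size s).+1 * rn u = m ^+ size s * (rn u * m)).
  by rewrite exprSr -mulrA [m * _]mulrC.
apply: (le_trans (IH _ _)) => [x xs|]; first by rewrite h // inE xs orbT.
rewrite ler_wpM2l ?exprn_ge0 // (le_trans (rnM _ _)) // ler_wpM2l //.
by rewrite h // inE eqxx.
Qed.

Section Homs.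
Variables (A B : banach_algebra R) (f : A -> B).
Hypothesis fh : is_hom f.

Lemma homD x y : f (x + y) = f x + f y. Proof. by case: fh. Qed.
Lemma homZ t x : f (t *: x) = t *: f x. Proof. by case: fh => _ []. Qed.
Lemma homM x y : f (x ** y) = f x ** f y. Proof. by case: fh => _ []. Qed.
Lemma hom0 : f 0 = 0.
Proof. by rewrite -(scale0r (0 : A)) homZ scale0r. Qed.
Lemma homN x : f (- x) = - f x.
Proof. by rewrite -scaleN1r homZ scaleN1r. Qed.
Lemma homB x y : f (x - y) = f x - f y.
Proof. by rewrite homD homN. Qed.

Lemma hom_foldl u s :
  f (foldl (ba_mul A) u s) = foldl (ba_mul B) (f u) (map f s).
Proof. by elim: s u => //= b s IH u; rewrite IH homM. Qed.

Lemma hom_inj : (forall x, f x = 0 -> x = 0) -> injective f.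
Proof. by move=> h x y xy; apply/subr0_eq/h; rewrite homB xy subrr. Qed.

Lemma hom_bounded : continuous f -> exists2 C : R, 0 < C & forall x, rn (f x) <= C * rn x.
Proof.
move=> /(_ 0); rewrite /continuous_at hom0 => fc.
have /fc/rn_nbhs[d d0 hd] : nbhs (0 : B) [set y | rn (0 - y) < 1].
  by apply/rn_nbhs; exists 1.
exists (2 / d) => [|x]; first by rewrite divr_gt0.
have [x0|x0] := eqVneq (rn x) 0.
  by rewrite (rn0_eq0 x0) hom0 !rn0 mulr0.
have xp : 0 < rn x by rewrite lt0r x0 /=.
pose t := d / (2 * rn x).
have t0 : 0 < t by rewrite divr_gt0 // mulr_gt0.
have /= := hd (t%:C%C *: x); rewrite !sub0r !rnN homZ !rnZr ?(ltW t0) // => h.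
have tx : t * rn x = d / 2 by rewrite /t; field.
have {h} : t * rn (f x) < 1 by apply: h; rewrite tx; lra.
rewrite mulrC -ltr_pdivlMr // => /ltW /le_trans; apply.
by rewrite le_eqVlt; apply/orP; left; apply/eqP; rewrite /t; field; rewrite x0 lt0r_neq0.
Qed.

Lemma bounded_hom (C : R) : (forall x, rn (f x) <= C * rn x) -> continuous f.
Proof.
move=> h x U /rn_nbhs[e e0 eU]; apply/rn_nbhs.
have C0 : 0 < `|C| + 1 by rewrite ltr_pwDr.
exists (e / (`|C| + 1)) => [|y xy /=]; first by rewrite divr_gt0.
apply: eU; rewrite -homB (le_lt_trans (h _)) //.
rewrite (@le_lt_trans _ _ ((`|C| + 1) * rn (x - y))) //.
  by apply: ler_wpM2r; [exact: rn_ge0|have := ler_norm C; lra].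
by rewrite mulrC -ltr_pdivlMr.
Qed.

End Homs.

Lemma hom_comp A B D (f : A -> B) (g : B -> D) :
  is_hom f -> is_hom g -> is_hom (g \o f).
Proof.
by move=> fh gh; split; [|split] => * /=; rewrite ?(homD fh, homZ fh, homM fh, homD gh, homZ gh, homM gh).
Qed.

(** Joint spectral radius 0 in a form fit for estimates: [C] absorbs short products, and the free
    first factor [u] lets products be cut and concatenated. *)
Definition quasinilpotent A (M : set A) := forall d : R, 0 < d -> exists2 C : R, 0 < C &
  forall u s, (forall x, x \in s -> M x) ->
    rn (foldl (ba_mul A) u s) <= C * d ^+ size s * rn u.

Definition cq_set A (I : set A) := forall M, M `<=` I -> tot_bounded M -> quasinilpotent M.

Lemma quasinilpotent_jsr A (M : set A) (m : R) : 0 < m -> (forall x, M x -> rn x <= m) ->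
  joint_spectral_radius_zero M <-> quasinilpotent M.
Proof.
move=> m0 Mm; split=> [h d d0|h _ /gt0_realE[r r0 ->]].
  have [|N hN] := h d%:C%C; first by rewrite ltcR.
  have c1 : 1 <= 1 + m / d by rewrite lerDl divr_ge0 // ltW.
  have c0 : 0 < 1 + m / d by rewrite (lt_le_trans ltr01).
  (* Products of at most [N] factors escape [hN]; each of their factors costs
     [m <= (1 + m / d) * d], whence the constant. *)
  exists ((1 + m / d) ^+ N) => [|u [|a s] hs]; first by rewrite exprn_gt0.
    by rewrite /= mulr1 ler_peMl // exprn_ege1.
  have [Ns|sN] := leqP N (size s).
    have := hN _ Ns a s erefl (hs _ (mem_head _ _)).
    move=> /(_ (fun x xs => hs _ (@mem_behead _ (a :: s) _ xs))).
    rewrite -rmorphXn /= norm_le /ba_prod => h1.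
    rewrite /= foldl_mulA (le_trans (rnM _ _)) // mulrC ler_wpM2r //.
    by rewrite (le_trans h1) // ler_peMl ?exprn_ege1 ?exprn_ge0 // ltW.
  rewrite (le_trans (@foldl_bound _ u m _ _ _)) ?(ltW m0) // => [x /hs /Mm //|].
  rewrite ler_wpM2r // (@le_trans _ _ ((1 + m / d) ^+ size (a :: s) * d ^+ size (a :: s))) //.
    rewrite -exprMn lerXn2r // ?nnegrE ?mulr_ge0 ?(ltW m0) ?(ltW d0) ?(ltW c0) //.
    have -> : (1 + m / d) * d = d + m by field; apply: lt0r_neq0.
    by rewrite lerDr ltW.
  by rewrite ler_wpM2r ?exprn_ge0 ?(ltW d0) // ler_weXn2l.
(* At [r / 2] the hypothesis leaves a factor [2^-1 ^+ n], which beats [C * m] for large [n]; [m]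
   bounds the first element [a], taken as [u]. *)
have r20 : 0 < r / 2 by rewrite divr_gt0.
have [C C0 hC] := h _ r20.
have [N hN] := half_exp_lt (C * m) r0.
exists N => n Nn a s sn Ma hs; rewrite -rmorphXn /= norm_le /ba_prod.
rewrite (le_trans (hC _ _ hs)) // sn (@le_trans _ _ (C * (r / 2) ^+ n * m)) //.
  by rewrite ler_wpM2l ?Mm // mulr_ge0 ?exprn_ge0 // ltW.
have -> : C * (r / 2) ^+ n * m = r ^+ n * (C * m * 2^-1 ^+ n).
  by rewrite exprMn; move: (r ^+ n) (2^-1 ^+ n) => x y; ring.
rewrite exprSr ler_wpM2l ?exprn_ge0 ?(ltW r0) // (le_trans _ (ltW hN)) //.
by rewrite ler_wpM2l ?half_exp_le // mulr_ge0 // ltW.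
Qed.

Lemma precompact_tot_bounded A (M : set A) :
  precompact_mod setT (fun x => x = 0) M <-> tot_bounded M.
Proof.
split=> [h|h _ /gt0_realE[e e0 ->]].
  apply: net_tot_bounded => e e0; have [|F [_ hF]] := h e%:C%C; first by rewrite ltcR.
  exists F => y /hF[f [fF [k ->]]]; rewrite subr0 norm_lt => yf.
  by exists f.
have [F [_ hF]] := tot_bounded_net h e0; exists F; split=> // y /hF[f fF yf].
by exists f; split=> //; exists 0; rewrite // subr0 norm_lt.
Qed.

Lemma cqE A (I : set A) : compactly_quasinilpotent_ideal I <-> cq_set I.
Proof.
split=> h M MI.
  move=> pM; have [m m0 Mm] := tot_bounded_bounded pM.
  by apply/(quasinilpotent_jsr m0 Mm)/h => //; apply/precompact_tot_bounded.
move=> /precompact_tot_bounded pM; have [m m0 Mm] := tot_bounded_bounded pM.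
by apply/(quasinilpotent_jsr m0 Mm)/h.
Qed.

End Algebra.

(** * Ideals and quotients as Banach algebras *)

Section BanachFromOperations.
Variables (R : realType) (Q : Type).
Variables (z : Q) (add : Q -> Q -> Q) (opp : Q -> Q) (sc : R[i] -> Q -> Q)
  (mul : Q -> Q -> Q) (nrm : Q -> R).
Hypotheses (addA : associative add) (addC : commutative add)
  (add0 : left_id z add) (addN : left_inverse z opp add).
Hypotheses (scA : forall a b v, sc a (sc b v) = sc (a * b) v)
  (sc1 : left_id 1 sc) (scDr : right_distributive sc add)
  (scDl : forall v a b, sc (a + b) v = add (sc a v) (sc b v)).
Hypotheses (mulA : associative mul) (mulDl : left_distributive mul add)
  (mulDr : right_distributive mul add)
  (mulZl : forall t a b, mul (sc t a) b = sc t (mul a b))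
  (mulZr : forall t a b, mul a (sc t b) = sc t (mul a b)).
Hypotheses (nrmD : forall x y, nrm (add x y) <= nrm x + nrm y)
  (nrmZ : forall t x, nrm (sc t x) = complex.Re `|t| * nrm x)
  (nrm0_eq0 : forall x, nrm x = 0 -> x = z)
  (nrmM : forall x y, nrm (mul x y) <= nrm x * nrm y).
Hypothesis complete : forall u : nat -> Q,
  (forall n, nrm (add (u n.+1) (opp (u n))) <= 2 * 2^-1 ^+ n) ->
  exists l, forall e : R, 0 < e ->
    exists n0, forall n, (n0 <= n)%N -> nrm (add l (opp (u n))) < e.

Definition carrier := Q.

HB.instance Definition _ := gen_eqMixin carrier.
HB.instance Definition _ := gen_choiceMixin carrier.
HB.instance Definition _ := GRing.isZmodule.Build carrier addA addC add0 addN.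
HB.instance Definition _ :=
  GRing.Zmodule_isLmodule.Build R[i] carrier scA sc1 scDr scDl.

Let cnorm (x : carrier) : R[i] := (nrm x)%:C%C.

Let cnormD (x y : carrier) : cnorm (x + y) <= cnorm x + cnorm y.
Proof. by rewrite /cnorm -rmorphD /= lecR nrmD. Qed.

Let cnormZ (t : R[i]) (x : carrier) : cnorm (t *: x) = `|t| * cnorm x.
Proof.
have e : `|t| = (complex.Re `|t|)%:C%C by rewrite RRe_real // normr_real.
by rewrite /cnorm nrmZ rmorphM [in RHS]e.
Qed.

Let cnorm0 (x : carrier) : cnorm x = 0 -> x = 0.
Proof. by case=> /nrm0_eq0. Qed.

HB.instance Definition _ :=
  Lmodule_isNormed.Build R[i] carrier cnormD cnormZ cnorm0.

Let carrier_complete (F : set_system carrier) :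
  ProperFilter F -> cauchy F -> cvg F.
Proof. exact: (@seq_complete R carrier). Qed.

HB.instance Definition _ := Uniform_isComplete.Build carrier carrier_complete.

Let cnormM (x y : carrier) : `|mul x y : carrier| <= `|x| * `|y|.
Proof. by rewrite /Num.norm /= /cnorm -rmorphM /= lecR nrmM. Qed.

Definition banach_of_operations : banach_algebra R :=
  @BanachAlgebra R carrier mul mulA mulDl mulDr mulZl mulZr cnormM.

(** Callers see the algebra only through a bijection respecting operations and norm, never through
    its structure instances. *)
Lemma banach_of_operationsP : exists (B : banach_algebra R) (to : Q -> B),
  bijective to /\
  (forall x y, to (add x y) = to x + to y) /\
  (forall t x, to (sc t x) = t *: to x) /\
  (forall x y, to (mul x y) = to x ** to y) /\
  (forall x, rn (to x) = nrm x).
Proof. by exists banach_of_operations, id; split=> //; exists id. Qed.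

End BanachFromOperations.

Section Ideals.
Variable R : realType.
Implicit Types A B C : banach_algebra R.

Lemma idealP A (I K : set A) : ideal_in I K ->
  [/\ K `<=` I, K 0, (forall x y, K x -> K y -> K (x + y)),
     (forall t x, K x -> K (t *: x)) &
     (forall a x, I a -> K x -> K (a ** x)) /\ (forall a x, I a -> K x -> K (x ** a))].
Proof.
move=> [KI [[K0 [KD KZ]] KM]]; split=> //.
by split=> a x Ia Kx; have [] := KM a x Ia Kx.
Qed.

Lemma idealN A (I K : set A) x : ideal_in I K -> K x -> K (- x).
Proof. by move=> /idealP[_ _ _ KZ _] Kx; rewrite -scaleN1r; apply: KZ. Qed.

Lemma idealB A (I K : set A) x y : ideal_in I K -> K x -> K y -> K (x - y).
Proof.
move=> KI Kx Ky; have Ny := idealN KI Ky; case: (idealP KI) => _ _ KD _ _.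
exact: KD.
Qed.

Lemma subalgebra_exists A (J : set A) : closed_ideal J ->
  exists (C : banach_algebra R) (i : C -> A), embeds_onto i J.
Proof.
move=> [idJ cJ]; have [_ J0 JD JZ [JM _]] := idealP idJ.
pose Q := {x : A | J x}.
have Qeq (x y : Q) : sval x = sval y -> x = y.
  by case: x y => [x Jx] [y Jy] /= e; subst y; congr exist; apply: Prop_irrelevance.
pose mk x (Jx : J x) : Q := exist _ x Jx.
have [||||||||||||||||||B [to [tob [toD [toZ [toM ton]]]]]] := @banach_of_operationsP R Q (mk 0 J0)
  (fun x y => mk _ (JD _ _ (svalP x) (svalP y)))
  (fun x => mk _ (idealN idJ (svalP x)))
  (fun t x => mk _ (JZ t _ (svalP x)))
  (fun x y => mk _ (JM (sval x) _ I (svalP y)))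
  (fun x => rn (sval x)).
- by move=> x y w; apply: Qeq; rewrite /= addrA.
- by move=> x y; apply: Qeq; rewrite /= addrC.
- by move=> x; apply: Qeq; rewrite /= add0r.
- by move=> x; apply: Qeq; rewrite /= addNr.
- by move=> a b x; apply: Qeq; rewrite /= scalerA.
- by move=> x; apply: Qeq; rewrite /= scale1r.
- by move=> a x y; apply: Qeq; rewrite /= scalerDr.
- by move=> x a b; apply: Qeq; rewrite /= scalerDl.
- by move=> x y w; apply: Qeq; rewrite /= ba_mulA.
- by move=> x y w; apply: Qeq; rewrite /= ba_mulDl.
- by move=> x y w; apply: Qeq; rewrite /= ba_mulDr.
- by move=> t x y; apply: Qeq; rewrite /= ba_mulZl.
- by move=> t x y; apply: Qeq; rewrite /= ba_mulZr.
- by move=> x y; apply: rnD.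
- by move=> t x; apply: rnZ.
- by move=> x /rn0_eq0 ?; apply: Qeq.
- by move=> x y; apply: rnM.
- move=> u hu; have [l hl] := @rcauchy_cvg R A (fun n => sval (u n)) 2 hu.
  have Jl : J l.
    refine (proj1 (closed_rnP J) cJ l _) => e e0; have [n hn] := half_exp_lt (2 * 2) e0.
    by exists (sval (u n)); [apply: svalP|apply: le_lt_trans (hl n) hn].
  exists (mk l Jl) => e e0; have [n0 hn] := half_exp_lt (2 * 2) e0.
  exists n0 => n nn; rewrite (le_lt_trans (hl n)) // (le_lt_trans _ hn) //.
  by rewrite ler_wpM2l ?mulr_ge0 // half_exp_le.
case: tob => fr toK frK.
exists B, (fun b => sval (fr b)); split; last split.
- split; [|split] => [x y|t x|x y]; rewrite -[x in LHS]frK.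
  + by rewrite -[y in LHS]frK -toD toK.
  + by rewrite -toZ toK.
  + by rewrite -[y in LHS]frK -toM toK.
- by move=> x; rewrite !normE -ton frK.
- apply/seteqP; split=> [_ [x _ <-]|x Jx]; first exact: svalP.
  by exists (to (mk x Jx)); rewrite // toK.
Qed.

End Ideals.

Section Quotient.
Variables (R : realType) (A : banach_algebra R) (K : set A).
Hypothesis cK : closed_ideal K.

Let idK : ideal_in setT K. Proof. by case: cK. Qed.
Let K0 : K 0. Proof. by case: (idealP idK). Qed.
Let KD x y : K x -> K y -> K (x + y). Proof. by case: (idealP idK) => _ _ + _ _; apply. Qed.
Let KZ t x : K x -> K (t *: x). Proof. by case: (idealP idK) => _ _ _ + _; apply. Qed.
Let KB x y : K x -> K y -> K (x - y). Proof. exact: idealB idK. Qed.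
Let KMl a x : K x -> K (a ** x). Proof. by case: (idealP idK) => _ _ _ _ [+ _]; apply. Qed.
Let KMr a x : K x -> K (x ** a). Proof. by case: (idealP idK) => _ _ _ _ [_ +]; apply. Qed.

Definition qnorm (x : A) : R := inf [set rn (x - k) | k in K].

Let qset x : has_inf [set rn (x - k) | k in K].
Proof.
split; first by exists (rn (x - 0)), 0.
by exists 0 => _ [k _ <-].
Qed.

Lemma qnorm_le x k : K k -> qnorm x <= rn (x - k).
Proof. by move=> Kk; apply: ge_inf; [case: (qset x)|exists k]. Qed.

Lemma qnorm_lt x (e : R) : 0 < e -> exists2 k, K k & rn (x - k) < qnorm x + e.
Proof. by move=> /inf_adherent/(_ (qset x))[_ [k Kk <-] lt]; exists k. Qed.

Lemma qnorm_glb x (c : R) : (forall k, K k -> c <= rn (x - k)) -> c <= qnorm x.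
Proof.
move=> h; apply: lb_le_inf; first by case: (qset x).
by move=> _ [k Kk <-]; apply: h.
Qed.

Lemma qnorm_mod x y : K (x - y) -> qnorm x = qnorm y.
Proof.
have le u v : K (u - v) -> qnorm u <= qnorm v.
  move=> uv; apply: qnorm_glb => k Kk; have := qnorm_le u (KD uv Kk).
  by rewrite opprD addrA subKr.
by move=> xy; apply/eqP; rewrite eq_le !le // -opprB; apply: idealN idK _.
Qed.

(** Cosets as a subtype: congruent points define the same predicate, so choice picks the same
    representative, and the fixed points of [rep] form the quotient. *)
Let rep (x : A) : A := xget 0 [set y | K (x - y)].

Let rep_mod x : K (x - rep x).
Proof. by rewrite /rep; case: xgetP => // /(_ x); rewrite /= subrr. Qed.

Let rep_eq x y : K (x - y) -> rep x = rep y.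
Proof.
move=> xy; rewrite /rep; congr xget; apply/seteqP; split=> w /= h.
  have -> : y - w = (x - w) - (x - y) by rewrite opprB [RHS]addrC addrA subrK.
  exact: KB.
by have -> : x - w = (x - y) + (y - w); [rewrite addrA subrK|exact: KD].
Qed.

Let rep_idem x : rep (rep x) = rep x.
Proof. by apply/esym/rep_eq. Qed.

Let Q := {x : A | rep x = x}.
Let pi (x : A) : Q := exist _ (rep x) (rep_idem x).

Let pi_eq x y : K (x - y) -> pi x = pi y.
Proof.
move=> /rep_eq xy; rewrite /pi; move: (rep_idem x) (rep_idem y); rewrite xy.
by move=> p q; congr exist; apply: Prop_irrelevance.
Qed.

Let pi_surj (q : Q) : exists x, q = pi x.
Proof.
case: q => x xr; exists x; rewrite /pi; move: (rep_idem x); rewrite xr => p.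
by congr exist; apply: Prop_irrelevance.
Qed.

Let pi_sval x : K (sval (pi x) - x).
Proof. by rewrite -opprB; apply: idealN idK _; apply: rep_mod. Qed.

Let qadd (x y : Q) : Q := pi (sval x + sval y).
Let qopp (x : Q) : Q := pi (- sval x).
Let qsc t (x : Q) : Q := pi (t *: sval x).
Let qmul (x y : Q) : Q := pi (sval x ** sval y).
Let qnrm (x : Q) : R := qnorm (sval x).

Let piD x y : qadd (pi x) (pi y) = pi (x + y).
Proof. by apply: pi_eq; rewrite opprD addrACA; apply: KD; apply: pi_sval. Qed.
Let piN x : qopp (pi x) = pi (- x).
Proof. by apply: pi_eq; rewrite -opprD; apply: idealN idK _; apply: pi_sval. Qed.
Let piZ t x : qsc t (pi x) = pi (t *: x).
Proof. by apply: pi_eq; rewrite -scalerBr; apply: KZ; apply: pi_sval. Qed.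
Let piM x y : qmul (pi x) (pi y) = pi (x ** y).
Proof.
apply: pi_eq; have -> : sval (pi x) ** sval (pi y) - x ** y =
  (sval (pi x) - x) ** sval (pi y) + x ** (sval (pi y) - y).
  by rewrite ba_mulBl ba_mulBr addrA subrK.
by apply: KD; [apply: KMr|apply: KMl]; apply: pi_sval.
Qed.
Let pinrm x : qnrm (pi x) = qnorm x.
Proof. by apply: qnorm_mod; apply: pi_sval. Qed.

Let qnorm_ge0 x : 0 <= qnorm x.
Proof. by apply: qnorm_glb => k _; apply: rn_ge0. Qed.

Let qnorm_leP x (c : R) : (forall e, 0 < e -> exists2 k, K k & rn (x - k) <= c + e) -> qnorm x <= c.
Proof.
move=> h; apply/ler_addgt0Pl => e e0; have [k Kk xk] := h e e0.
by rewrite (le_trans (qnorm_le _ Kk)) // [e + c]addrC.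
Qed.

Let qnormD x y : qnorm (x + y) <= qnorm x + qnorm y.
Proof.
apply: qnorm_leP => e e0; have e20 : 0 < e / 2 by rewrite divr_gt0.
have [k Kk xk] := qnorm_lt x e20; have [l Kl yl] := qnorm_lt y e20.
exists (k + l); first exact: KD.
by rewrite opprD addrACA (le_trans (rnD _ _)) //; lra.
Qed.

(** Near-optimal representatives enter one factor at a time: first for [v] with [k] fixed, then the
    infimum over [k]. That last move divides by [qnorm y], so the value 0 is treated apart. *)
Let qnormM x y : qnorm (x ** y) <= qnorm x * qnorm y.
Proof.
have step u v k : K k -> qnorm (u ** v) <= rn (u - k) * qnorm v.
  move=> Kk; apply: qnorm_leP => e e0.
  have d0 : 0 < e / (rn (u - k) + 1) by rewrite divr_gt0 // ltr_pwDr.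
  have [l Kl vl] := qnorm_lt v d0.
  exists (k ** v + (u - k) ** l); first by apply: KD; [apply: KMr|apply: KMl].
  have -> : u ** v - (k ** v + (u - k) ** l) = (u - k) ** (v - l).
    by rewrite [RHS]ba_mulBr [(u - k) ** v]ba_mulBl opprD addrA.
  rewrite (le_trans (rnM _ _)) // (le_trans (ler_wpM2l _ (ltW vl))) //.
  rewrite mulrDr lerD2l mulrCA ler_piMr ?(ltW e0) // ler_pdivrMr ?ltr_pwDr //.
  by rewrite mul1r lerDl.
have [y0|y0] := eqVneq (qnorm y) 0.
  by rewrite y0 mulr0 (le_trans (step x y 0 K0)) // y0 mulr0.
have yp : 0 < qnorm y by rewrite lt0r y0 qnorm_ge0.
by rewrite -ler_pdivrMr //; apply: qnorm_glb => k Kk; rewrite ler_pdivrMr // step.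
Qed.

(** One inequality for all scalars suffices: at [t^-1] and [t *: x] it yields the reverse one. *)
Let qnormZ (t : R[i]) x : qnorm (t *: x) = complex.Re `|t| * qnorm x.
Proof.
have n0 (s : R[i]) : 0 <= complex.Re `|s| by rewrite -ler0c RRe_real ?normr_real.
have le s y : qnorm (s *: y) <= complex.Re `|s| * qnorm y.
  apply: qnorm_leP => e e0.
  have d0 : 0 < e / (complex.Re `|s| + 1) by rewrite divr_gt0 // ltr_pwDr.
  have [l Kl vl] := qnorm_lt y d0.
  exists (s *: l); first exact: KZ.
  rewrite -scalerBr rnZ (le_trans (ler_wpM2l _ (ltW vl))) //.
  rewrite mulrDr lerD2l mulrCA ler_piMr ?(ltW e0) // ler_pdivrMr ?ltr_pwDr //.
  by rewrite mul1r lerDl.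
apply/eqP; rewrite eq_le le andTb.
have [->|t0] := eqVneq t 0; first by rewrite normr0 mul0r qnorm_ge0.
have tp : 0 < complex.Re `|t|.
  by rewrite lt0r n0 andbT; apply: contra_neq t0 => e; apply/normr0_eq0;
    rewrite -[LHS]RRe_real ?normr_real //; congr (_%:C)%C.
rewrite mulrC -ler_pdivlMr // mulrC.
have := le t^-1 (t *: x); rewrite scalerA mulVf // scale1r normfV.
suff -> : complex.Re (`|t|^-1) = (complex.Re `|t|)^-1 by [].
have e : `|t| = (complex.Re `|t|)%:C%C by rewrite RRe_real // normr_real.
by rewrite [in LHS]e -fmorphV.
Qed.

Let q_complete (u : nat -> Q) :
  (forall n, qnrm (qadd (u n.+1) (qopp (u n))) <= 2 * 2^-1 ^+ n) ->
  exists l, forall e : R, 0 < e ->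
    exists n0, forall n, (n0 <= n)%N -> qnrm (qadd l (qopp (u n))) < e.
Proof.
move=> hu.
(* Representatives are chosen successively, each near the previous one. The 3 is the 2 in the rate
   of [u] plus 1 for the slack [2^-1 ^+ n] in approaching the infimum. *)
have step (p : nat * A) : exists b, pi p.2 = u p.1 ->
    pi b = u p.1.+1 /\ rn (b - p.2) <= 3 * 2^-1 ^+ p.1.
  case: p => n a /=; have [ea|] := pselect (pi a = u n); last by exists 0.
  have [b eb] := pi_surj (u n.+1).
  have := hu n; rewrite -ea eb piN piD pinrm => ba.
  have [|k Kk bk] := @qnorm_lt (b - a) (2^-1 ^+ n); first by rewrite exprn_gt0.
  exists (b - k) => _; split; last by rewrite addrAC; lra.
  by apply: pi_eq; rewrite addrAC subrr add0r; apply: idealN idK _.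
have [g hg] := choice step; have [a0 e0] := pi_surj (u 0%N).
pose fix a n := if n is m.+1 then g (m, a m) else a0.
have ha n : pi (a n) = u n.
  by elim: n => [|n IH] //=; case: (hg (n, a n) IH).
have [n|l hl] := @rcauchy_cvg _ _ a 3; first by case: (hg (n, a n) (ha n)).
exists (pi l) => e e0'; have [n0 hn] := half_exp_lt (2 * 3) e0'.
exists n0 => n nn; rewrite -ha piN piD pinrm.
rewrite (le_lt_trans (qnorm_le _ K0)) // subr0 (le_lt_trans (hl n)) //.
by rewrite (le_lt_trans _ hn) // ler_wpM2l ?mulr_ge0 // half_exp_le.
Qed.

Lemma quotient_exists : exists (B : banach_algebra R) (q : A -> B), quotient_map q K.
Proof.
have [||||||||||||||||||B [to [tob [toD [toZ [toM ton]]]]]] :=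
  @banach_of_operationsP R Q (pi 0) qadd qopp qsc qmul qnrm.
- move=> x y w; case: (pi_surj x) (pi_surj y) (pi_surj w) => a -> [b ->] [c ->].
  by rewrite !piD addrA.
- by move=> x y; case: (pi_surj x) (pi_surj y) => a -> [b ->]; rewrite !piD addrC.
- by move=> x; case: (pi_surj x) => a ->; rewrite piD add0r.
- by move=> x; case: (pi_surj x) => a ->; rewrite piN piD addNr.
- by move=> a b x; case: (pi_surj x) => c ->; rewrite !piZ scalerA.
- by move=> x; case: (pi_surj x) => c ->; rewrite !piZ scale1r.
- move=> t x y; case: (pi_surj x) (pi_surj y) => a -> [b ->].
  by rewrite !(piD, piZ) scalerDr.
- by move=> x s t; case: (pi_surj x) => a ->; rewrite !(piD, piZ) scalerDl.
- move=> x y w; case: (pi_surj x) (pi_surj y) (pi_surj w) => a -> [b ->] [c ->].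
  by rewrite !piM ba_mulA.
- move=> x y w; case: (pi_surj x) (pi_surj y) (pi_surj w) => a -> [b ->] [c ->].
  by rewrite !(piM, piD) ba_mulDl.
- move=> x y w; case: (pi_surj x) (pi_surj y) (pi_surj w) => a -> [b ->] [c ->].
  by rewrite !(piM, piD) ba_mulDr.
- move=> t x y; case: (pi_surj x) (pi_surj y) => a -> [b ->].
  by rewrite !(piM, piZ) ba_mulZl.
- move=> t x y; case: (pi_surj x) (pi_surj y) => a -> [b ->].
  by rewrite !(piM, piZ) ba_mulZr.
- move=> x y; case: (pi_surj x) (pi_surj y) => a -> [b ->].
  by rewrite piD !pinrm.
- by move=> t x; case: (pi_surj x) => a ->; rewrite piZ !pinrm.
- move=> x; case: (pi_surj x) => a ->; rewrite pinrm => a0; apply: pi_eq.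
  rewrite subr0; apply: (proj1 (closed_rnP K) (proj2 cK)) => e e0.
  by have [k Kk ak] := qnorm_lt a e0; exists k; rewrite // -[e]add0r -a0.
- move=> x y; case: (pi_surj x) (pi_surj y) => a -> [b ->].
  by rewrite piM !pinrm.
- exact: q_complete.
case: tob => fr toK frK.
exists B, (to \o pi); split; last split; last split; last split.
- by split; [|split] => *; rewrite /= -?toD -?toZ -?toM ?piD ?piZ ?piM.
- by move=> y; case: (pi_surj (fr y)) => x e; exists x; rewrite /= -e frK.
- move=> x /=; split=> [x0|Kx].
    have : qnorm x = 0 by rewrite -pinrm -ton x0 rn0.
    move=> qx; apply: (proj1 (closed_rnP K) (proj2 cK)) => e e0.
    by have [k Kk ak] := qnorm_lt x e0; exists k; rewrite // -[e]add0r -qx.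
  apply: rn0_eq0; rewrite ton pinrm; apply/eqP; rewrite eq_le qnorm_ge0 andbT.
  by rewrite (le_trans (qnorm_le _ Kx)) // subrr rn0.
- by move=> x k Kk /=; rewrite !normE lecR ton pinrm qnorm_le.
- move=> x _ /gt0_realE[e e0 ->]; have [k Kk xk] := qnorm_lt x e0.
  by exists k; rewrite // !normE -rmorphD ltcR /= ton pinrm.
Qed.

End Quotient.

(** * The open mapping theorem *)

Section OpenMapping.
Variable R : realType.
Implicit Types A B : banach_algebra R.

(** The limit is located by the [n]-th step itself, which may be far below the geometric rate. The
    Baire argument needs this, its radii not being prescribed in advance. *)
Lemma rcauchy_cvg_rates (V : completeNormedModType R[i]) (u : nat -> V) (r : nat -> R) :
  (forall n, rn (u n.+1 - u n) <= r n) -> (forall n, r n.+1 <= r n / 2) ->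
  exists l, forall n, rn (l - u n) <= 2 * r n.
Proof.
move=> hu hr.
have rk n k : r (n + k)%N <= r n * 2^-1 ^+ k.
  elim: k => [|k IH]; first by rewrite addn0 mulr1.
  rewrite addnS (le_trans (hr _)) // exprSr mulrA ler_wpM2r //.
have r0 n : 0 <= r n by apply: le_trans (hu n).
have [n|l hl] := @rcauchy_cvg _ _ u (r 0%N).
  by rewrite (le_trans (hu n)) // -[n in r n]add0n rk.
exists l => n; apply/ler_addgt0Pl => e e0.
have [m hm] := half_exp_lt (2 * r 0%N) e0.
have := @rcauchy_tail _ _ (fun k => u (n + k)%N) (r n) _ 0%N m.
rewrite addn0 add0n expr0 => t.
have {}t : rn (u (n + m)%N - u n) <= 2 * r n.
  rewrite (le_trans (t _)) => [//|k|]; first by rewrite addnS (le_trans (hu _)).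
  by rewrite ler_piMr ?mulr_ge0 // gerBl exprn_ge0.
have l1 := hl (n + m)%N.
have l2 : 2 * r 0%N * 2^-1 ^+ (n + m) <= 2 * r 0%N * 2^-1 ^+ m.
  by rewrite ler_wpM2l ?mulr_ge0 // half_exp_le // leq_addl.
have := rn_triangle (u (n + m)%N) l (u n); lra.
Qed.

(** Baire category: if no [F n] were dense in a ball, centres could be chosen successively away from
    [F 0], [F 1], and so on, and their limit would be covered by none of them. *)
Lemma baire_cover (V : completeNormedModType R[i]) (F : nat -> set V) :
  (forall b, exists n, F n b) ->
  exists n (b0 : V), exists2 r : R, 0 < r & forall b, rn (b - b0) < r ->
    forall e : R, 0 < e -> exists2 b', F n b' & rn (b - b') < e.
Proof.
move=> cov; apply: contrapT => nh.
have ex (p : nat * (V * R)) : exists q : V * R, 0 < p.2.2 ->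
    [/\ rn (q.1 - p.2.1) <= p.2.2, 0 < q.2, q.2 <= p.2.2 / 2 &
        forall b', F p.1 b' -> 2 * q.2 < rn (q.1 - b')].
  case: p => n [b0 r] /=; have [r0|] := pselect (0 < r); last by exists (0, 0).
  apply: contrapT => nq; apply: nh; exists n, b0, r => // b br e e0.
  apply: contrapT => nb; apply: nq.
  (* [e / 4] keeps [F n] at more than twice the new radius from [b], and the limit moves by at most
     twice that radius; [r / 2] makes the radii decay. *)
  exists (b, Num.min (e / 4) (r / 2)) => _ /=; split.
  - exact: ltW.
  - by rewrite lt_min !divr_gt0.
  - by rewrite ge_min lexx orbT.
  - move=> b' Fb'; rewrite ltNge; apply/negP => le; apply: nb; exists b' => //.
    rewrite (le_lt_trans le) //.
    have : Num.min (e / 4) (r / 2) <= e / 4 by rewrite ge_min lexx.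
    lra.
have [g hg] := choice ex.
pose fix st n : V * R := if n is m.+1 then g (m, st m) else (0, 1).
have sp n : 0 < (st n).2 by elim: n => [|n IH] //=; case: (hg (n, st n) IH).
have [n|n|l hl] := @rcauchy_cvg_rates V (fun n => (st n).1) (fun n => (st n).2).
- by case: (hg (n, st n) (sp n)).
- by case: (hg (n, st n) (sp n)).
have [n Fl] := cov l.
case: (hg (n, st n) (sp n)) => _ _ _ /(_ l Fl) /=.
by have := hl n.+1; rewrite /= rnBC => /le_lt_trans h /h; rewrite ltxx.
Qed.

(** By Baire the image of a ball is dense in some ball; differences move it to 0 ([small]), scaling
    gives approximate preimages of proportional norm ([approx]), and correcting the error repeatedly
    gives exact ones. *)
Lemma open_mapping A B (f : A -> B) : is_hom f -> continuous f ->
  (forall y, exists x, f x = y) ->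
  exists2 C : R, 0 < C & forall y, exists2 x, f x = y & rn x <= C * rn y.
Proof.
move=> fh fc fs; have [L L0 fL] := hom_bounded fh fc.
have [b|n [b0 [r r0 hr]]] := @baire_cover B (fun n => [set f a | a in [set a | rn a <= n%:R]]).
  have [a <-] := fs b; exists (Num.truncn (rn a)).+1, a => //=.
  by rewrite ltW // truncnS_gt.
have small b e : rn b < r -> 0 < e -> exists2 a, rn a <= 2 * n%:R & rn (b - f a) < e.
  move=> br e0; have e20 : 0 < e / 2 by rewrite divr_gt0.
  have [|_ [a1 /= a1n <-] h1] := hr (b0 + b) _ _ e20; first by rewrite addrAC subrr add0r.
  have [|_ [a2 /= a2n <-] h2] := hr b0 _ _ e20; first by rewrite subrr rn0.
  exists (a1 - a2); first by have := rnB a1 a2; lra.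
  have -> : b - f (a1 - a2) = (b0 + b - f a1) - (b0 - f a2).
    by rewrite (homB fh) !opprB [RHS]addrC !addrA subrK [b + _]addrC.
  by have := rnB (b0 + b - f a1) (b0 - f a2); lra.
(* The first term rescales [small] from norm [r / 2]; the 1 keeps [K] positive when [n] is 0. *)
pose K := 4 * n%:R / r + 1.
have K0 : 0 < K by rewrite ltr_pwDr // divr_ge0 ?mulr_ge0 // ltW.
have approx b e : 0 < e -> exists2 a, rn a <= K * rn b & rn (b - f a) <= e.
  move=> e0; have [b0'|bn] := eqVneq (rn b) 0.
    exists 0; rewrite ?(hom0 fh) ?rn0 ?b0' ?mulr0 // subr0 b0' ltW //.
  have bp : 0 < rn b by rewrite lt0r bn /=.
  pose t := r / (2 * rn b); have t0 : 0 < t by rewrite divr_gt0 // mulr_gt0.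
  have tn : t%:C%C != 0 :> R[i] by apply/eqP => -[] /eqP; rewrite (gt_eqF t0).
  have [||a an ba] := small (t%:C%C *: b) (t * e); last first.
  - exists (t^-1%:C%C *: a).
      rewrite rnZr ?invr_ge0 ?(ltW t0) // (le_trans (ler_wpM2l _ an)) ?invr_ge0 ?(ltW t0) //.
      have -> : t^-1 * (2 * n%:R) = 4 * n%:R / r * rn b.
        by rewrite /t; field; rewrite bn lt0r_neq0.
      by rewrite ler_wpM2r // lerDl.
    rewrite -(ler_pM2l t0) -rnZr ?(ltW t0) // scalerBr -(homZ fh) scalerA -rmorphM.
    by rewrite /= divff ?lt0r_neq0 // scale1r ltW.
  - exact: mulr_gt0.
  - rewrite rnZr ?(ltW t0) //.
    have -> : t * rn b = r / 2 by rewrite /t; field.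
    by lra.
(* The successive corrections are at most [K * rn b * 2^-1 ^+ m], with sum [2 * K * rn b]. *)
exists (2 * K) => [|b]; first by rewrite mulr_gt0.
have [b0'|bn] := eqVneq (rn b) 0.
  by exists 0; rewrite ?(hom0 fh) ?rn0 ?b0' ?mulr0 // (rn0_eq0 b0').
have bp : 0 < rn b by rewrite lt0r bn /=.
have ex (p : nat * A) : exists a, rn a <= K * rn (b - f p.2) /\
    rn (b - f p.2 - f a) <= rn b * 2^-1 ^+ p.1.+1.
  have [|a ? ?] := approx (b - f p.2) (rn b * 2^-1 ^+ p.1.+1).
    by rewrite mulr_gt0 // exprn_gt0.
  by exists a.
have [g hg] := choice ex.
pose fix u n := if n is m.+1 then u m + g (m, u m) else 0.
have hu m : rn (b - f (u m)) <= rn b * 2^-1 ^+ m.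
  case: m => [|m] /=; first by rewrite (hom0 fh) subr0 mulr1.
  by rewrite (homD fh) opprD addrA; case: (hg (m, u m)).
have [m|l hl] := @rcauchy_cvg _ _ u (K * rn b).
  rewrite /= addrAC subrr add0r; case: (hg (m, u m)) => /= h _.
  by rewrite (le_trans h) // -mulrA ler_pM2l.
exists l; last by have := hl 0%N; rewrite /= subr0 mulr1 mulrA.
apply/esym/subr0_eq/rn_le0 => e e0.
have [m hm] := half_exp_lt (rn b + L * (2 * (K * rn b))) e0.
rewrite (le_trans (rn_triangle (f (u m)) _ _)) // -(homB fh) (le_trans _ (ltW hm)) //.
rewrite mulrDl lerD // (le_trans (fL _)) // rnBC -mulrA ler_pM2l //.
Qed.

End OpenMapping.

(** * Algebras without compact elements and compactly quasinilpotent ideals *)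

Section Semisimple.
Variable R : realType.
Implicit Types A B C D : banach_algebra R.

Definition compact_elt A (a : A) := tot_bounded [set a ** x ** a | x in [set x | rn x < 1]].

Definition cq_free B :=
  forall I : set B, closed_ideal I -> cq_set I -> forall x, I x -> x = 0.

Definition semisimple B := (forall a : B, compact_elt a -> a = 0) /\ cq_free B.

Lemma tot_bounded_mul A (S1 S2 : set A) : tot_bounded S1 -> tot_bounded S2 ->
  tot_bounded [set z | exists x y, [/\ S1 x, S2 y & z = x ** y]].
Proof.
move=> p1 p2; have [m m0 hm] := tot_bounded_bounded p1; have [k k0 hk] := tot_bounded_bounded p2.
apply: (@tot_bounded_map2 _ _ _ _ S1 S2 _ (fun x y z => z = x ** y) (m + k)) => //.
move=> x1 x2 _ x1' x2' _ s1 s2 s1' s2' -> ->.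
have -> : x1 ** x2 - x1' ** x2' = (x1 - x1') ** x2 + x1' ** (x2 - x2').
  by rewrite ba_mulBl ba_mulBr addrA subrK.
rewrite (le_trans (rnD _ _)) // (le_trans (lerD (rnM _ _) (rnM _ _))) //.
have ha : rn x2 <= m + k by rewrite (le_trans (hk _ s2)) // lerDr ltW.
have hb : rn x1' <= m + k by rewrite (le_trans (hm _ s1')) // lerDl ltW.
by rewrite mulrDr lerD //; [rewrite mulrC|]; rewrite ler_wpM2r.
Qed.

(** After at most two leftover factors a product over [M] splits into blocks of three, which lie in
    [I]; quasinilpotence of the blocks at [d ^+ 3] amounts to [d] per factor. *)
Lemma cq_cube A (I P : set A) :
  (forall x y z, P x -> P y -> P z -> I (x ** y ** z)) -> cq_set I -> cq_set P.
Proof.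
move=> PI cI M MP pM; have [m m0 hm] := tot_bounded_bounded pM.
pose M2 : set A := [set z | exists x y, [/\ M x, M y & z = x ** y]].
pose M3 : set A := [set z | exists x y, [/\ M2 x, M y & z = x ** y]].
have qM3 : quasinilpotent M3.
  apply: cI; last by apply: tot_bounded_mul => //; apply: tot_bounded_mul.
  by move=> _ [_ [z [[x [y [Mx My ->]]] Mz ->]]]; apply: PI; apply: MP.
move=> d d0; have [|C C0 hC] := qM3 (d ^+ 3); first by rewrite exprn_gt0.
(* As [m <= c * d], the leftover factors cost at most [c ^+ 2] beyond their share of [d]. *)
pose c := 1 + m / d.
have c1 : 1 <= c by rewrite lerDl divr_ge0 // ltW.
exists (C * c ^+ 2) => [|u s hs].
  by rewrite mulr_gt0 // exprn_gt0 // (lt_le_trans ltr01).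
have group k : forall s, (forall x, x \in s -> M x) -> size s = (3 * k)%N ->
    exists t, [/\ size t = k, (forall x, x \in t -> M3 x) &
      forall u, foldl (ba_mul A) u s = foldl (ba_mul A) u t].
  elim: k => [|k IH] s' hs'; first by move/size0nil->; exists [::].
  case: s' hs' => [|x [|y [|w s']]]; rewrite ?mulnS // => hs' [semisimple'].
  have [||t [tk tM te]] := IH s' => [v vs||].
  - by apply: hs'; rewrite !inE vs !orbT.
  - exact: semisimple'.
  exists (x ** y ** w :: t); split=> [|v|v]; first by rewrite /= tk.
  - rewrite inE => /orP[/eqP->|/tM //].
    exists (x ** y), w; split=> //; last by apply: hs'; rewrite !inE eqxx !orbT.
    by exists x, y; split=> //; apply: hs'; rewrite !inE eqxx ?orbT.
  - by rewrite /= te !ba_mulA.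
pose r := (size s %% 3)%N; pose k := (size s %/ 3)%N.
have sE : size s = (r + 3 * k)%N by rewrite addnC mulnC /r /k -divn_eq.
have r3 : (r <= 2)%N by rewrite -ltnS ltn_mod.
have [||t [tk tM te]] := group k (drop r s) => [x /mem_drop /hs //||].
  by rewrite size_drop sE addKn.
rewrite -{1}(cat_take_drop r s) foldl_cat te.
apply: le_trans (hC _ _ tM) _; rewrite tk sE exprD -exprM.
have h1 : rn (foldl (ba_mul A) u (take r s)) <= m ^+ r * rn u.
  have -> : r = size (take r s) by rewrite size_takel // sE leq_addr.
  have := @foldl_bound R A u m (take r s) (ltW m0).
  rewrite size_takel ?sE ?leq_addr // => h; apply: h => x /mem_take /hs; exact: hm.
have h2 : m ^+ r <= c ^+ 2 * d ^+ r.
  have -> : m = m / d * d by rewrite divfK // gt_eqF.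
  rewrite exprMn ler_wpM2r ?exprn_ge0 ?(ltW d0) //.
  rewrite (@le_trans _ _ (c ^+ r)) ?ler_weXn2l //.
  have md : 0 <= m / d by rewrite divr_ge0 // ltW.
  by rewrite lerXn2r ?nnegrE ?(le_trans ler01 c1) // /c lerDr.
have dk : 0 <= C * d ^+ (3 * k) by rewrite mulr_ge0 ?exprn_ge0 // ltW.
apply: le_trans (ler_wpM2l dk h1) _.
apply: le_trans (ler_wpM2l dk (ler_wpM2r (rn_ge0 u) h2)) _.
rewrite le_eqVlt; apply/orP; left; apply/eqP.
move: (d ^+ (3 * k)) (c ^+ 2) (d ^+ r) => x y w; ring.
Qed.

Lemma cq_zero A : cq_set [set (0 : A)].
Proof.
move=> M M0 _ d d0; exists 1 => // u [|a s] hs /=; first by rewrite !mul1r.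
have /M0 -> : M a by apply: hs; rewrite mem_head.
rewrite ba_mul0r.
have -> : foldl (ba_mul A) 0 s = 0 by elim: s {hs} => //= b s; rewrite ba_mul0l.
by rewrite rn0 mul1r mulr_ge0 ?exprn_ge0 // ltW.
Qed.

Lemma closed_zeros (V W : normedModType R[i]) (P : Type) (g : P -> V -> W) (k : P -> R) :
  (forall p x y, rn (g p x - g p y) <= k p * rn (x - y)) ->
  closed [set x | forall p, g p x = 0].
Proof.
move=> h; apply/closed_rnP => x hx p; apply: rn_le0 => e e0.
have k0 : 0 < `|k p| + 1 by rewrite ltr_pwDr.
have [|y y0 xy] := hx (e / (`|k p| + 1)); first by rewrite divr_gt0.
have := h p x y; rewrite (y0 p) subr0 => /le_trans; apply.
rewrite ltr_pdivlMr // in xy; apply: le_trans (ltW xy).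
by rewrite mulrC ler_wpM2l // (le_trans (ler_norm _)) // lerDl.
Qed.

Lemma rn_mul3B A (c c' x y : A) :
  rn (c ** x ** c' - c ** y ** c') <= rn c * rn c' * rn (x - y).
Proof.
rewrite -ba_mulBl -ba_mulBr (le_trans (rnM _ _)) // mulrAC ler_wpM2r //.
exact: rnM.
Qed.

(** The elements killed by all sandwiches form a closed ideal [N]. A product of three of them is 0,
    being a sandwich of the middle one, so [cq_cube] over the zero ideal applies. *)
Lemma cq_free_nil B (b : B) : cq_free B -> (forall c c', c ** b ** c' = 0) -> b = 0.
Proof.
move=> hB hb.
pose N : set B := [set x | forall p : B * B, p.1 ** x ** p.2 = 0].
apply: (hB N); last by move=> p; apply: hb.
- split; last first.
    apply: (@closed_zeros _ _ _ (fun p x => p.1 ** x ** p.2) (fun p => rn p.1 * rn p.2)).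
    by move=> p x y; apply: rn_mul3B.
  split=> //; split.
    split; first by move=> p; rewrite ba_mul0r ba_mul0l.
    split=> [x y hx hy p|t x hx p]; first by rewrite ba_mulDr ba_mulDl hx hy addr0.
    by rewrite ba_mulZr ba_mulZl hx scaler0.
  move=> a x _ hx; split=> -[c c'] /=.
    by rewrite ba_mulA; apply: (hx (_, _)).
  by rewrite -!ba_mulA ba_mulA; apply: (hx (_, _)).
- apply: cq_cube (@cq_zero B) => x y z _ hy _; exact: (hy (_, _)).
Qed.

(** Each [y] is approached through finite nets, and each correction is lifted with the norm control
    of the open mapping theorem. All [n]-th stages lie in one finite set [G n], whatever [y] is, so
    the limits form a totally bounded set. *)
Lemma tot_bounded_lift A B (f : A -> B) (M : set B) : is_hom f -> continuous f ->
  (forall y, exists x, f x = y) -> tot_bounded M ->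
  exists2 N : set A, tot_bounded N & forall y, M y -> exists2 x, N x & f x = y.
Proof.
move=> fh fc fs pM; have [K K0 hK] := open_mapping fh fc fs.
have [L L0 hL] := hom_bounded fh fc.
have exl b : exists a, f a = b /\ rn a <= K * rn b by have [a ? ?] := hK b; exists a.
have [lam hlam] := choice exl.
have exF n : exists F : seq B, forall y, M y -> exists2 b, b \in F & rn (y - b) < 2^-1 ^+ n.
  have [|F [_ hF]] := tot_bounded_net pM (_ : 0 < 2^-1 ^+ n); first by rewrite exprn_gt0.
  by exists F.
have [F hF] := choice exF.
have exy (p : B * nat) : exists b, M p.1 -> b \in F p.2 /\ rn (p.1 - b) < 2^-1 ^+ p.2.
  have [Mp|] := pselect (M p.1); last by exists 0.
  by have [b ? ?] := hF p.2 _ Mp; exists b.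
have [g hg] := choice exy.
pose fix xs y n := if n is m.+1 then xs y m + lam (g (y, m.+1) - f (xs y m))
                   else lam (g (y, 0%N)).
pose fix G n := if n is m.+1 then [seq x + lam (b - f x) | x <- G m, b <- F m.+1]
                else map lam (F 0%N).
have fxs y n : f (xs y n) = g (y, n).
  case: n => [|n] /=; first by case: (hlam (g (y, 0%N))).
  by rewrite (homD fh) (proj1 (hlam _)) addrC subrK.
have xsG y n : M y -> xs y n \in G n.
  move=> My; elim: n => [|n IH] /=.
    by rewrite map_f //; case: (hg (y, 0%N) My).
  apply/allpairsP; exists (xs y n, g (y, n.+1)); split=> //.
  by case: (hg (y, n.+1) My).
have exlim y : exists l, M y -> forall n, rn (l - xs y n) <= 2 * (2 * K) * 2^-1 ^+ n.
  have [My|] := pselect (M y); last by exists 0.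
  have [n|l hl] := @rcauchy_cvg _ _ (xs y) (2 * K); last by exists l.
  rewrite /= addrAC subrr add0r fxs.
  rewrite (le_trans (proj2 (hlam _))) // [2 * K]mulrC -mulrA ler_pM2l //.
  rewrite (le_trans (rn_triangle y _ _)) //.
  have := proj2 (hg (y, n) My); have := proj2 (hg (y, n.+1) My) => /=.
  by rewrite rnBC; have := half_exp_le R (leqnSn n); lra.
have [l hl] := choice exlim.
exists [set l y | y in M].
  apply: net_tot_bounded => e e0; have [n hn] := half_exp_lt (2 * (2 * K)) e0.
  exists (G n) => _ [y My <-]; exists (xs y n); first exact: xsG.
  exact: le_lt_trans (hl y My n) hn.
move=> y My; exists (l y); first by exists y.
apply/subr0_eq/rn_le0 => e e0.
have [n hn] := half_exp_lt (L * (2 * (2 * K)) + 1) e0.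
rewrite (le_trans (rn_triangle (f (xs y n)) _ _)) // (le_trans _ (ltW hn)) //.
rewrite mulrDl mul1r lerD //; last first.
  by rewrite fxs rnBC; apply/ltW; case: (hg (y, n) My).
by rewrite -(homB fh) (le_trans (hL _)) // -mulrA ler_pM2l // hl.
Qed.

Lemma map_lift A B (f : A -> B) (N : set A) (s : seq B) :
  (forall x, x \in s -> exists2 y, N y & f y = x) ->
  exists2 t, (forall x, x \in t -> N x) & map f t = s.
Proof.
elim: s => [|b s IH] h; first by exists [::].
have [|t tN ts] := IH => [x xs|]; first by apply: h; rewrite inE xs orbT.
have [a Na ab] := h b (mem_head _ _).
exists (a :: t); last by rewrite /= ab ts.
by move=> x; rewrite inE => /orP[/eqP->|/tN].
Qed.

(** A product in [B] is the image of a product of lifts; the estimate over the lifted set descends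
    at the cost [K] of lifting [u] and [L] of applying [f]. *)
Lemma cq_image A B (f : A -> B) : is_hom f -> continuous f ->
  (forall y, exists x, f x = y) -> cq_set [set: A] -> cq_set [set: B].
Proof.
move=> fh fc fs cA M _ pM; have [N pN hN] := tot_bounded_lift fh fc fs pM.
have [L L0 hL] := hom_bounded fh fc; have [K K0 hK] := open_mapping fh fc fs.
move=> d d0; have [C C0 hC] := cA N (fun=> fun=> I) pN d d0.
exists (L * C * K) => [|u s hs]; first by rewrite !mulr_gt0.
have [v <- vu] := hK u.
have [|t tN <-] := @map_lift A B f N s; first by move=> x /hs /hN.
rewrite -(hom_foldl fh) size_map (le_trans (hL _)) // -!mulrA ler_pM2l //.
rewrite (le_trans (hC _ _ tN)) // -!mulrA ler_pM2l // [X in _ <= X]mulrCA.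
by rewrite ler_pM2l ?exprn_gt0.
Qed.

Lemma quotient_mapP A B (q : A -> B) (K : set A) : quotient_map q K ->
  [/\ is_hom q, continuous q, (forall y, exists x, q x = y),
      (forall x, q x = 0 <-> K x) &
      (forall x, K 0 -> rn (q x) <= rn x)].
Proof.
move=> [qh [qs [qk [ql _]]]].
have q1 x : K 0 -> rn (q x) <= rn x.
  by move=> K0; have := ql x 0 K0; rewrite subr0 !normE lecR.
split=> //; apply: (bounded_hom qh (C := 1)) => x; rewrite mul1r q1 //.
by apply/qk; rewrite (hom0 qh).
Qed.

Lemma embedsP C A (i : C -> A) (J : set A) : embeds_onto i J ->
  [/\ is_hom i, (forall x, rn (i x) = rn x), injective i, (forall x, J (i x)) &
      (forall a, J a -> exists x, i x = a)].
Proof.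
move=> [ih [iN <-]].
have rni x : rn (i x) = rn x by apply: complexI; rewrite -!normE.
split=> //; last by move=> _ [x _ <-]; exists x.
by apply: (hom_inj ih) => x x0; apply: rn0_eq0; rewrite -rni x0 rn0.
Qed.

Lemma idealE A (K : set A) : K 0 -> (forall x y, K x -> K y -> K (x + y)) ->
  (forall t x, K x -> K (t *: x)) ->
  (forall a x, K x -> K (a ** x) /\ K (x ** a)) -> ideal_in setT K.
Proof. by move=> K0 KD KZ KM; split=> //; split=> // a x _; apply: KM. Qed.

Lemma closed_ideal_preimage A B (f : A -> B) (K : set B) : is_hom f -> continuous f ->
  closed_ideal K -> closed_ideal (f @^-1` K).
Proof.
move=> fh fc [idK cK]; have [_ K0 KD KZ [KMl KMr]] := idealP idK.
have [L L0 hL] := hom_bounded fh fc.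
split.
  apply: idealE => /=.
  - by rewrite (hom0 fh).
  - by move=> u v Ku Kv; rewrite (homD fh); apply: KD.
  - by move=> t u Ku; rewrite (homZ fh); apply: KZ.
  - by move=> c u Ku; rewrite !(homM fh); split; [apply: KMl|apply: KMr].
apply/closed_rnP => u hu /=; apply: (proj1 (closed_rnP K) cK) => e e0.
have [|v Kv uv] := hu (e / L); first by rewrite divr_gt0.
exists (f v) => //; rewrite -(homB fh) (le_lt_trans (hL _)) //.
by rewrite mulrC -ltr_pdivlMr.
Qed.

Lemma closed_ideal0 A : closed_ideal [set (0 : A)].
Proof.
split; last first.
  by apply/closed_rnP => x hx; apply: rn_le0 => e /hx[y -> /ltW]; rewrite subr0.
apply: idealE => //= [_ _ -> ->|t _ ->|a _ ->]; first by rewrite addr0.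
  by rewrite scaler0.
by rewrite ba_mul0r ba_mul0l.
Qed.

Lemma hom_factor A B D (q : A -> B) (f : A -> D) :
  is_hom q -> continuous q -> (forall y, exists x, q x = y) ->
  is_hom f -> continuous f -> (forall x, q x = 0 -> f x = 0) ->
  exists g : B -> D, [/\ is_hom g, continuous g & forall x, g (q x) = f x].
Proof.
move=> qh qc qs fh fc qf; have [K K0 hK] := open_mapping qh qc qs.
have [L L0 hL] := hom_bounded fh fc.
have exs b : exists c, q c = b /\ rn c <= K * rn b by have [c ? ?] := hK b; exists c.
have [sg hsg] := choice exs; pose g b := f (sg b).
have gq x : g (q x) = f x.
  by apply/subr0_eq; rewrite -(homB fh) qf // (homB qh) (proj1 (hsg _)) subrr.
have gh : is_hom g.
  split; [|split] => [x y|s x|x y].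
  - by case: (qs x) (qs y) => c <- [c' <-]; rewrite -(homD qh) !gq (homD fh).
  - by case: (qs x) => c <-; rewrite -(homZ qh) !gq (homZ fh).
  - by case: (qs x) (qs y) => c <- [c' <-]; rewrite -(homM qh) !gq (homM fh).
exists g; split=> //; apply: (bounded_hom gh (C := L * K)) => b.
by rewrite (le_trans (hL _)) // -mulrA ler_pM2l //; case: (hsg b).
Qed.

End Semisimple.

Section Closure.
Variables (R : realType) (D B : banach_algebra R) (g : D -> B).
Hypotheses (gh : is_hom g) (gc : continuous g) (gi : injective g).

(** Through the injection [g], [D] is a Banach right module over [B]: the product is measured in the
    norm of [D], which that of [B] need not control. *)
Definition right_action_bounded (K : R) := forall (x : D) (b : B),
  exists2 y, g y = g x ** b & rn y <= K * rn x * rn b.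

Lemma foldl_mulD (u v : B) s :
  foldl (ba_mul B) (u + v) s = foldl (ba_mul B) u s + foldl (ba_mul B) v s.
Proof. by elim: s u v => //= a s IH u v; rewrite ba_mulDl IH. Qed.

(* Cover M by finitely many small balls around points g p, p in F, and let E be
   the set of differences.  The union HH of the sets F E^k / lam^k is totally
   bounded in P when E is small compared with lam, so long products of its
   elements are negligible; a product of n elements of M expands into 2^n
   terms, each of which is essentially lam^n times a product over HH. *)
Lemma cq_closure (K : R) (P : set D) : 0 < K -> right_action_bounded K ->
  (forall x b y, P x -> g y = g x ** b -> P y) -> cq_set P ->
  cq_set [set b | forall e : R, 0 < e -> exists2 p, P p & rn (b - g p) < e].
Proof.
move=> K0 act PR cP M MP pM d d0.
have [L L0 hL] := hom_bounded gh gc.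
(* Halving [d] pays for the [2 ^+ n] terms of the expansion. The second bound in [ep] makes right
   multiplication by [sl e], for [e] in [E], at least halve the norm of [D], so that the sets [H k]
   shrink geometrically. *)
pose lam := d / 2; have lam0 : 0 < lam by rewrite divr_gt0.
pose ep := Num.min lam (lam / (2 * K)).
have ep0 : 0 < ep by rewrite lt_min lam0 divr_gt0 // mulr_gt0.
have epl : ep <= lam by rewrite ge_min lexx.
have epK : K * (lam^-1 * ep) <= 2^-1.
  rewrite mulrCA ler_pdivrMl // mulrC.
  have : ep <= lam / (2 * K) by rewrite ge_min lexx orbT.
  rewrite ler_pdivlMr ?mulr_gt0 //; lra.
have li : 0 <= lam^-1 by rewrite invr_ge0 ltW.
pose sl (e : B) := lam^-1%:C%C *: e.
have rnsl e : rn (sl e) = lam^-1 * rn e by rewrite rnZr.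
have [F FP hF] : exists2 F : seq D, (forall p, p \in F -> P p) &
    forall y, M y -> exists2 p, p \in F & rn (y - g p) < ep.
  have e20 : 0 < ep / 2 by rewrite divr_gt0.
  have [F0 [F0M hF0]] := tot_bounded_net pM e20.
  have ex y : exists p, M y -> P p /\ rn (y - g p) < ep / 2.
    have [/MP/(_ _ e20)[p Pp yp]|] := pselect (M y); last by exists 0.
    by exists p.
  have [h hh] := choice ex.
  exists (map h F0) => [_ /mapP[y /F0M My ->]|y My]; first by case: (hh y My).
  have [f fF yf] := hF0 y My.
  exists (h f); first exact: map_f.
  have [_] := hh f (F0M _ fF).
  by have := rn_triangle f y (g (h f)); lra.
pose E : set B := [set e | rn e < ep /\ exists y p, [/\ M y, p \in F & e = y - g p]].
have pE : tot_bounded E.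
  apply: (@tot_bounded_map2 _ _ _ _ M [set p | p \in F] _ (fun y p e => e = y - g p) (1 + L)) => //.
  - exact: tot_bounded_seq.
  - by move=> e [_ [y [p [? ? ?]]]]; exists y, p.
  - move=> y p _ y' p' _ _ _ _ _ -> ->.
    have -> : y - g p - (y' - g p') = (y - y') - g (p - p').
      by rewrite (homB gh) !opprD !opprK addrACA.
    rewrite (le_trans (rnB _ _)) // mulrDl mul1r lerD ?lerDl // (le_trans (hL _)) //.
    by rewrite ler_pM2l // lerDr.
pose fix H k : set D := if k is j.+1 then
    [set y | exists h e, [/\ H j h, E e & g y = g h ** sl e]] else [set x | x \in F].
have HP k x : H k x -> P x.
  elim: k x => [|k IH] x /=; first exact: FP.
  by move=> [h [e [/IH Ph _ ge]]]; apply: PR Ph ge.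
have [m m0 hm] := tot_bounded_bounded (@tot_bounded_seq _ _ F).
have Hstep h e y : E e -> g y = g h ** sl e -> rn y <= rn h / 2.
  move=> [ee _] ge; have [y' gy' hy'] := act h (sl e).
  have -> : y = y' by apply: gi; rewrite ge.
  rewrite (le_trans hy') // rnsl mulrAC mulrC ler_wpM2l //.
  by rewrite (le_trans _ epK) // ler_pM2l // ler_wpM2l // ltW.
have Hm k x : H k x -> rn x <= m * 2^-1 ^+ k.
  elim: k x => [|k IH] x /=; first by rewrite mulr1; apply: hm.
  move=> [h [e [/IH Hh Ee ge]]]; rewrite (le_trans (Hstep _ _ _ Ee ge)) //.
  by rewrite exprSr mulrA ler_pM2r.
have pH k : tot_bounded (H k).
  elim: k => [|k IH] /=; first exact: tot_bounded_seq.
  apply: (@tot_bounded_map2 _ _ _ _ (H k) E _ (fun h e y => g y = g h ** sl e)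
    (K * (lam^-1 * (ep + m))) IH pE).
    by move=> y [h [e [? ? ?]]]; exists h, e.
  move=> h e y h' e' y' Hh [ee _] Hh' _ gy gy'.
  have [z1 g1 n1] := act (h - h') (sl e); have [z2 g2 n2] := act h' (sl (e - e')).
  have -> : y - y' = z1 + z2.
    apply: gi; rewrite (homB gh) (homD gh) gy gy' g1 g2 (homB gh) ba_mulBl /sl.
    by rewrite scalerBr ba_mulBr addrA subrK.
  have hm' : rn h' <= m.
    rewrite (le_trans (Hm _ _ Hh')) // ler_piMr ?(ltW m0) //.
    by rewrite exprn_ile1 // ltW // ?invf_lt1 ?ltr1n.
  rewrite (le_trans (rnD _ _)) // (le_trans (lerD n1 n2)) // !rnsl.
  have -> : K * rn (h - h') * (lam^-1 * rn e) + K * rn h' * (lam^-1 * rn (e - e')) =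
    K * (lam^-1 * (rn e * rn (h - h') + rn h' * rn (e - e'))) by ring.
  rewrite -!mulrA ler_pM2l // ler_wpM2l // mulrDr lerD //; apply: ler_wpM2r => //.
    by rewrite (le_trans (ltW ee)) // lerDl ltW.
  by rewrite (le_trans hm') // lerDr ltW.
pose HH : set D := [set x | exists k, H k x].
have pHH : tot_bounded HH by apply: tot_bounded_bigU Hm.
have HHe v e : HH v -> E e -> exists2 v', HH v' & g v ** e = lam%:C%C *: g v'.
  move=> [k Hv] Ee; have [v' gv' _] := act v (sl e).
  exists v'; first by exists k.+1, v, e.
  rewrite gv' /sl ba_mulZr scalerA -rmorphM /= divff ?scale1r // lt0r_neq0 //.
have [C1 C10 hC1] := cP HH (fun x '(ex_intro k Hk) => HP k x Hk) pHH _ lam0.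
have [mh mh0 hmh] := tot_bounded_bounded pHH.
pose C2 := 1 + L * C1 * mh / lam.
have C20 : 0 <= L * C1 * mh / lam by rewrite !mulr_ge0 ?invr_ge0 ?(ltW mh0) ?(ltW L0) ?(ltW C10) ?(ltW lam0).
exists C2 => [|u s hs]; first by rewrite ltr_pwDl.
pose c0 := rn u.
(* [U n x]: x is a product of n factors e + g h, regrouped into a prefix of
   small norm followed by the image of a product of elements of HH. *)
pose U n x := rn x <= c0 * lam ^+ n \/ exists t h w,
  [/\ rn t * lam ^+ (size w).+1 <= c0 * lam ^+ n, HH h, (forall v, v \in w -> HH v) &
      x = t ** g (foldl (ba_mul D) h w)].
have Ubound n x : U n x -> rn x <= C2 * (c0 * lam ^+ n).
  have cn : 0 <= c0 * lam ^+ n by rewrite mulr_ge0 ?exprn_ge0 ?rn_ge0 ?(ltW lam0).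
  case=> [h|[t [h [w [tw Hh Hw ->]]]]].
    by rewrite (le_trans h) // mulrDl mul1r lerDl mulr_ge0.
  rewrite (le_trans (rnM _ _)) // (@le_trans _ _ (rn t * (L * (C1 * lam ^+ size w * mh)))) //.
    rewrite ler_wpM2l // (le_trans (hL _)) // ler_pM2l // (le_trans (hC1 _ _ Hw)) //.
    by rewrite ler_wpM2l ?hmh // mulr_ge0 ?exprn_ge0 // ltW.
  rewrite mulrDl mul1r.
  have -> : rn t * (L * (C1 * lam ^+ size w * mh)) =
      L * C1 * mh / lam * (rn t * lam ^+ (size w).+1).
    by rewrite exprSr; move: (lam ^+ size w) => y; field; apply: lt0r_neq0.
  by rewrite (le_trans (ler_wpM2l C20 tw)) // lerDr.
have lamS n (x : R) : x <= c0 * lam ^+ n -> x * lam <= c0 * lam ^+ n.+1.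
  by move=> h; rewrite exprSr mulrA ler_pM2r.
have Ustep n x p e : p \in F -> E e -> U n x -> U n.+1 (x ** g p) /\ U n.+1 (x ** e).
  move=> pF Ee [xn|[t [h [w [tw Hh Hw ->]]]]].
    split.
      by right; exists x, p, [::]; split=> //=; [rewrite expr1; apply: lamS|exists 0%N].
    left; rewrite (le_trans (rnM _ _)) // (le_trans _ (lamS _ _ xn)) //.
    by rewrite ler_wpM2l // (le_trans _ epl) // ltW //; case: Ee.
  split; right.
    exists t, h, (rcons w p); split=> //.
    - by rewrite size_rcons exprSr mulrA; apply: lamS.
    - by move=> v; rewrite mem_rcons inE => /orP[/eqP->|/Hw //]; exists 0%N.
    - by rewrite -cats1 foldl_cat /= (homM gh) ba_mulA.
  (* Multiplying by [e] does not lengthen the word: its last element ([h] if [w] is empty) absorbs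
     [e] within [HH], and the scalar [lam] that comes out goes to [t]. *)
  have lt : rn (lam%:C%C *: t) * lam ^+ (size w).+1 <= c0 * lam ^+ n.+1.
    by rewrite rnZr ?(ltW lam0) // -mulrA mulrC; apply: lamS.
  case: (lastP w) tw Hw lt => [|w' v] tw Hw lt.
    have [h' Hh' eh'] := HHe _ _ Hh Ee.
    by exists (lam%:C%C *: t), h', [::]; split; rewrite //= -ba_mulA eh' ba_mulZl ba_mulZr.
  have Hv : HH v by apply: Hw; rewrite mem_rcons mem_head.
  have [v' Hv' ev'] := HHe v e Hv Ee.
  exists (lam%:C%C *: t), h, (rcons w' v'); split=> //.
  - by move: lt; rewrite !size_rcons.
  - move=> q; rewrite mem_rcons inE => /orP[/eqP-> //|qw]; apply: Hw.
    by rewrite mem_rcons inE qw orbT.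
  - rewrite -!cats1 !foldl_cat /= !(homM gh) -!ba_mulA ev' ba_mulZl.
    by rewrite !ba_mulZr.
have main : forall s n x, (forall y, y \in s -> M y) -> U n x ->
    rn (foldl (ba_mul B) x s) <= 2 ^+ size s * (C2 * (c0 * lam ^+ (n + size s))).
  elim=> [|y s' IH] n x hs' Ux; first by rewrite /= mul1r addn0; apply: Ubound.
  have My : M y by apply: hs'; rewrite mem_head.
  have [p pF yp] := hF y My.
  have Ee : E (y - g p) by split=> //; exists y, p.
  have [U1 U2] := Ustep n x p _ pF Ee Ux.
  have hs2 v : v \in s' -> M v by move=> vs; apply: hs'; rewrite inE vs orbT.
  rewrite /= -[y in x ** y](subrK (g p)) ba_mulDr foldl_mulD.
  rewrite (le_trans (rnD _ _)) // (le_trans (lerD (IH _ _ hs2 U2) (IH _ _ hs2 U1))) //.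
  by rewrite addSnnS exprS -mulrA mulr_natl mulr2n.
have := main s 0%N u hs; rewrite add0n => /(_ (or_introl _)) h.
rewrite (le_trans (h _)) ?mulr1 // /c0 /lam expr_div_n.
rewrite le_eqVlt; apply/orP; left; apply/eqP.
have : 2 ^+ size s != 0 :> R by rewrite expf_neq0.
by move: (2 ^+ size s) (d ^+ size s) => a b a0; field.
Qed.

End Closure.

(** * Passing between an ideal and the whole algebra *)

Section Transfer.
Variable R : realType.
Implicit Types A B C D E : banach_algebra R.

Lemma compact_elt_ball A (a : A) (T : R) : 0 < T -> compact_elt a ->
  tot_bounded [set a ** x ** a | x in [set x | rn x < T]].
Proof.
move=> T0 ca; apply: (@tot_bounded_map _ _ _ _ _ (fun y z => z = T%:C%C *: y) T ca).
  move=> _ [x /= xT <-]; exists (a ** (T^-1%:C%C *: x) ** a).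
    exists (T^-1%:C%C *: x) => //=.
    by rewrite rnZr ?invr_ge0 ?(ltW T0) // mulrC ltr_pdivrMr // mul1r.
  rewrite ba_mulZr ba_mulZl scalerA -rmorphM /= divff ?scale1r // lt0r_neq0 //.
by move=> x y x' y' _ _ -> ->; rewrite -scalerBr rnZr // ltW.
Qed.

Section IdealRange.
Variables (D B : banach_algebra R) (g : D -> B) (K : R).
Hypotheses (gh : is_hom g) (gc : continuous g) (gi : injective g) (K0 : 0 < K).
Hypothesis actl : forall (b : B) (x : D), exists y, g y = b ** g x.
Hypothesis actr : right_action_bounded g K.

(** Elements of [B] acting on [x] slide onto the outer factors of [d ** x ** d'], so [P] is stable
    under [B] even where [I] is not. [P] contains [I], and its cube lies in [I], so [cq_cube] and
    then [cq_closure] apply. *)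
Lemma cq_free_ideal_range : cq_free B -> cq_free D.
Proof.
move=> hB I [idI _] cI x Ix.
have [_ I0 ID IZ [IMl IMr]] := idealP idI.
pose P : set D := [set x | forall p : D * D, I (p.1 ** x ** p.2)].
pose Q : set B := [set b | forall e : R, 0 < e -> exists2 p, P p & rn (b - g p) < e].
have PQ p : P p -> Q (g p) by move=> Pp e e0; exists p; rewrite // subrr rn0.
have Pl b p y : P p -> g y = b ** g p -> P y.
  move=> Pp gy [d d'] /=; have [y2 gy2 _] := actr d b.
  have -> : d ** y ** d' = y2 ** p ** d'.
    by apply: gi; rewrite !(homM gh) gy gy2 !ba_mulA.
  exact: (Pp (_, _)).
have Pr p b y : P p -> g y = g p ** b -> P y.
  move=> Pp gy [d d'] /=; have [y2 gy2] := actl b d'.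
  have -> : d ** y ** d' = d ** p ** y2.
    by apply: gi; rewrite !(homM gh) gy gy2 !ba_mulA.
  exact: (Pp (_, _)).
have cQ : closed_ideal Q.
  split; last first.
    apply/closed_rnP => b hb e e0; have e20 : 0 < e / 2 by rewrite divr_gt0.
    have [b' Qb' bb'] := hb _ e20; have [p Pp b'p] := Qb' _ e20.
    by exists p => //; have := rn_triangle b' b (g p); lra.
  apply: idealE.
  - rewrite -(hom0 gh); apply: PQ => p; rewrite ba_mul0r ba_mul0l; exact: I0.
  - move=> b b' Qb Qb' e e0; have e20 : 0 < e / 2 by rewrite divr_gt0.
    have [p Pp bp] := Qb _ e20; have [p' Pp' bp'] := Qb' _ e20.
    exists (p + p'); first by move=> q; rewrite ba_mulDr ba_mulDl; apply: ID.
    by rewrite (homD gh) opprD addrACA; have := rnD (b - g p) (b' - g p'); lra.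
  - move=> t b Qb e e0.
    have t0 : 0 <= complex.Re `|t| by rewrite -ler0c RRe_real ?normr_real.
    have [|p Pp bp] := Qb (e / (complex.Re `|t| + 1)).
      by rewrite divr_gt0 // ltr_pwDr.
    exists (t *: p); first by move=> q; rewrite ba_mulZr ba_mulZl; apply: IZ.
    rewrite (homZ gh) -scalerBr rnZ; rewrite ltr_pdivlMr ?ltr_pwDr // mulrDr mulr1 in bp.
    by have := rn_ge0 (b - g p); rewrite mulrC; lra.
  - move=> a b Qb; have a1 : 0 < rn a + 1 by rewrite ltr_pwDr.
    split=> e e0; have [|p Pp] := Qb (e / (rn a + 1)); rewrite ?divr_gt0 // ltr_pdivlMr // => bp.
      have [y gy] := actl a p; exists y; first exact: Pl gy.
      rewrite gy -ba_mulBr (le_lt_trans (rnM _ _)) //.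
      by have := rn_ge0 (b - g p); rewrite mulrC; lra.
    have [y gy _] := actr p a; exists y; first exact: Pr gy.
    rewrite gy -ba_mulBl (le_lt_trans (rnM _ _)) //.
    by have := rn_ge0 (b - g p); lra.
have cqQ : cq_set Q.
  apply: (@cq_closure _ D B g gh gc gi K P K0 actr Pr).
  by apply: cq_cube cI => a b c _ hb _; apply: (hb (_, _)).
apply: gi; rewrite (hom0 gh); apply: (hB Q cQ cqQ); apply: PQ => p.
by apply: IMr => //; apply: IMl.
Qed.

(** For [x] in [B], (d a d') x (d a d') = d (a (d' x d) a) d' and d' x d comes from [D]. So d a d'
    is compact in [B], hence 0, and [cq_free_nil] gives [a = 0]. *)
Lemma semisimple_ideal_range : semisimple B -> semisimple D.
Proof.
move=> [cB fB]; have fD := cq_free_ideal_range fB; split=> // a ca.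
apply: cq_free_nil => // d d'; apply: gi; rewrite (hom0 gh); apply: cB.
have [L L0 hL] := hom_bounded gh gc.
pose T := K * rn d' * rn d + 1.
have T0 : 0 < T by rewrite ltr_pwDr // !mulr_ge0 // ltW.
apply: (@tot_bounded_map _ _ _ _ _ (fun w z => z = g (d ** w ** d')) (L * (rn d * rn d'))
  (compact_elt_ball T0 ca)).
  move=> _ [x /= x1 <-]; have [y1 gy1 ny1] := actr d' x.
  exists (a ** (y1 ** d) ** a).
    exists (y1 ** d) => //=; rewrite (le_lt_trans (rnM _ _)) //.
    rewrite /T (@le_lt_trans _ _ (K * rn d' * rn d)) ?ltrDl // ler_wpM2r //.
    by rewrite (le_trans ny1) // ler_piMr ?(ltW x1) // mulr_ge0 // ltW.
  by rewrite !(homM gh) gy1 !ba_mulA.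
move=> w _ w' _ _ _ -> ->; rewrite -(homB gh) (le_trans (hL _)) // -mulrA ler_pM2l //.
exact: rn_mul3B.
Qed.

End IdealRange.

Section Sandwich.
Variables (B E : banach_algebra R) (g : B -> E) (K : R).
Hypotheses (gh : is_hom g) (gc : continuous g) (gi : injective g) (K0 : 0 < K).
Hypothesis act : forall (b b' : B) (e : E),
  exists2 y, g y = g b ** e ** g b' & rn y <= K * rn b * rn b' * rn e.
Hypothesis nondeg : forall e : E, (forall b b', g b ** e ** g b' = 0) -> e = 0.

(** Products are controlled in the norm of [E] only; the outer factors [u] and [v] bring the middle
    part back to the norm of [B] through [act]. *)
Lemma cq_preimage (Q : set E) : cq_set Q -> cq_set (g @^-1` Q).
Proof.
move=> cQ M MQ pM; have [L L0 hL] := hom_bounded gh gc.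
have [m m0 hm] := tot_bounded_bounded pM.
have pgM : tot_bounded (g @` M).
  apply: (@tot_bounded_map _ _ _ _ _ (fun x y => y = g x) L pM) => [_ [x Mx <-]|]; first by exists x.
  by move=> x _ x' _ _ _ -> ->; rewrite -(homB gh).
have gMQ : g @` M `<=` Q by move=> _ [x /MQ Qx <-].
move=> d d0; have [C C0 hC] := cQ _ gMQ pgM d d0.
(* The constants 1, [c1] and [c2] serve products of no, one and at least two factors. In the last
   case the first and last factors are split off, and [d ^+ 2] makes up for them. *)
pose c2 := K * m * m * C * L / d ^+ 2; pose c1 := m / d.
have c20 : 0 <= c2.
  by rewrite /c2 !mulr_ge0 ?invr_ge0 ?exprn_ge0 ?(ltW K0) ?(ltW m0) ?(ltW C0) ?(ltW L0) ?(ltW d0).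
have c10 : 0 <= c1 by rewrite divr_ge0 // ltW.
exists (1 + c1 + c2) => [|u s hs]; first by rewrite ltr_pwDl // ltr_pwDl.
have aux (c r x : R) : c <= 1 + c1 + c2 -> 0 <= r -> x <= c * r -> x <= (1 + c1 + c2) * r.
  by move=> h1 h2 h3; rewrite (le_trans h3) // ler_wpM2r.
rewrite -mulrA; have du n : 0 <= d ^+ n * rn u by rewrite mulr_ge0 ?exprn_ge0 // ltW.
case: s hs => [|a s] hs.
  by apply: (aux 1) => //=; rewrite ?mul1r //; lra.
have Ma : M a by apply: hs; rewrite mem_head.
case: (lastP s) hs => [|s' v] hs.
  apply: (aux c1) => //=; first by lra.
  rewrite (le_trans (rnM _ _)) // expr1 /c1 mulrA divfK ?gt_eqF // mulrC ler_wpM2r //.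
  exact: hm.
have Mv : M v by apply: hs; rewrite inE mem_rcons mem_head orbT.
have s'M x : x \in map g s' -> (g @` M) x.
  move=> /mapP[y ys ->]; exists y => //; apply: hs.
  by rewrite inE mem_rcons inE ys !orbT.
apply: (aux c2) => //; first by lra.
rewrite -cats1 -[a :: _]/([:: a] ++ (s' ++ [:: v])) /= foldl_cat /= foldl_mulA.
have [y gy ny] := act u v (foldl (ba_mul E) (g a) (map g s')).
have -> : u ** foldl (ba_mul B) a s' ** v = y.
  by apply: gi; rewrite gy !(homM gh) (hom_foldl gh).
rewrite (le_trans ny) //.
have h1 := hC (g a) _ s'M; rewrite size_map in h1.
have h2 : rn (g a) <= L * m by rewrite (le_trans (hL _)) // ler_pM2l // hm.
have h3 : rn (foldl (ba_mul E) (g a) (map g s')) <= C * d ^+ size s' * (L * m).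
  by rewrite (le_trans h1) // ler_wpM2l // mulr_ge0 ?exprn_ge0 // ltW.
have h4 : K * rn u * rn v <= K * rn u * m by rewrite ler_wpM2l ?hm // mulr_ge0 // ltW.
have k0 : 0 <= K * rn u * rn v by rewrite !mulr_ge0 // ltW.
rewrite (le_trans (ler_pM k0 (rn_ge0 _) h4 h3)) //.
rewrite size_cat addn1 !exprSr /c2 le_eqVlt; apply/orP; left; apply/eqP.
by move: (d ^+ size s') => x; field; rewrite gt_eqF.
Qed.

(** The identity (b a b') x (b a b') = b (a (b' x b) a) b' again, now with [a] in [E] and [x] in
    [B]. An ideal [Q] of [E] is likewise tested on its preimage in [B], which contains the
    sandwiches of its elements. *)
Lemma semisimple_sandwich : semisimple B -> semisimple E.
Proof.
move=> [cB fB]; have [L L0 hL] := hom_bounded gh gc; split.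
  move=> a ca; apply: nondeg => b b'; have [y gy _] := act b b' a.
  suff y0 : y = 0 by rewrite -gy y0 (hom0 gh).
  apply: cB; pose T := L * (rn b' * rn b) + 1.
  have T0 : 0 < T by rewrite ltr_pwDr // !mulr_ge0 // ltW.
  apply: (@tot_bounded_map _ _ _ _ _ (fun w z => g z = g b ** w ** g b') (K * rn b * rn b')
    (compact_elt_ball T0 ca)).
    move=> _ [x /= x1 <-]; exists (a ** g (b' ** x ** b) ** a).
      exists (g (b' ** x ** b)) => //=; rewrite (le_lt_trans (hL _)) //.
      rewrite /T (@le_lt_trans _ _ (L * (rn b' * rn b))) ?ltrDl // ler_pM2l //.
      rewrite (le_trans (rnM _ _)) // ler_wpM2r // (le_trans (rnM _ _)) //.
      by rewrite ler_piMr // ltW.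
    by rewrite !(homM gh) gy !ba_mulA.
  move=> w z w' z' _ _ gz gz'; have [y' gy' ny'] := act b b' (w - w').
  suff -> : z - z' = y' by [].
  by apply: gi; rewrite (homB gh) gz gz' gy' ba_mulBr ba_mulBl.
move=> Q cQ cqQ x Qx; have [_ _ _ _ [QMl QMr]] := idealP (proj1 cQ).
apply: nondeg => b b'; have [y gy _] := act b b' x.
suff y0 : y = 0 by rewrite -gy y0 (hom0 gh).
apply: (fB (g @^-1` Q)); last by rewrite /= gy; apply: QMr => //; apply: QMl.
  exact: closed_ideal_preimage.
exact: cq_preimage.
Qed.

End Sandwich.

(** Dividing [A] by the kernel of [f] would not do: no non-zero element of the quotient may be
    killed by all sandwiches from [B], and dividing by [N] enforces just that. On [J] nothing more
    is lost: if f(J c J) = 0, all sandwiches of [f c] in [B] vanish, so [f c = 0]. *)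
Lemma semisimple_quotient_extend A B C (J : set A) (i : C -> A) (f : C -> B) :
  closed_ideal J -> embeds_onto i J ->
  is_hom f -> continuous f -> (forall y, exists x, f x = y) ->
  semisimple B -> (exists b : B, b <> 0) ->
  exists E (h : A -> E), [/\ is_hom h, continuous h, (forall y, exists x, h x = y),
    semisimple E & exists c, h (i c) <> 0].
Proof.
move=> [idJ _] /embedsP[ih iN ii iJ Ji] fh fc fs sB [b0 b0n].
have [L L0 hL] := hom_bounded fh fc; have [K K0 hK] := open_mapping fh fc fs.
have [_ J0 JD JZ [JMl JMr]] := idealP idJ.
have ext (q : (C * C) * A) : exists t, i t = i q.1.1 ** q.2 ** i q.1.2.
  by apply: Ji; apply: JMl.
have [t' ht'] := choice ext.
pose t (p : C * C) a := t' (p, a).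
have ht p a : i (t p a) = i p.1 ** a ** i p.2 by rewrite /t ht'.
have tB p x y : t p x - t p y = t p (x - y).
  by apply: ii; rewrite (homB ih) !ht ba_mulBr ba_mulBl.
have tn p x : rn (t p x) <= rn p.1 * rn p.2 * rn x.
  rewrite -iN ht; have := rn_mul3B (i p.1) (i p.2) x 0.
  by rewrite ba_mul0r ba_mul0l !subr0 !iN.
pose N : set A := [set x | forall p, f (t p x) = 0].
have cN : closed_ideal N.
  split; last first.
    apply: (@closed_zeros _ _ _ _ (fun p x => f (t p x)) (fun p => L * (rn p.1 * rn p.2))).
    by move=> p x y; rewrite -(homB fh) tB (le_trans (hL _)) // -mulrA ler_pM2l.
  apply: idealE.
  - move=> p; have -> : t p 0 = 0 by apply: ii; rewrite ht ba_mul0r ba_mul0l (hom0 ih).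
    exact: hom0.
  - move=> x y Nx Ny p; have -> : t p (x + y) = t p x + t p y.
      by apply: ii; rewrite (homD ih) !ht ba_mulDr ba_mulDl.
    by rewrite (homD fh) Nx Ny addr0.
  - move=> s x Nx p; have -> : t p (s *: x) = s *: t p x.
      by apply: ii; rewrite (homZ ih) !ht ba_mulZr ba_mulZl.
    by rewrite (homZ fh) Nx scaler0.
  - move=> a x Nx; split=> -[c c'].
      have [c2 ic2] : exists c2, i c2 = i c ** a by apply: Ji; apply: JMr.
      have -> : t (c, c') (a ** x) = t (c2, c') x by apply: ii; rewrite !ht /= ic2 !ba_mulA.
      exact: Nx.
    have [c2 ic2] : exists c2, i c2 = a ** i c' by apply: Ji; apply: JMl.
    have -> : t (c, c') (x ** a) = t (c, c2) x by apply: ii; rewrite !ht /= ic2 !ba_mulA.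
    exact: Nx.
have [E [h hq]] := quotient_exists cN.
have [hh hc hs hk hn] := quotient_mapP hq.
have N0 : N 0 by case: (idealP (proj1 cN)).
have [|||phi [phih phic phif]] := @hom_factor R _ _ _ f (h \o i) fh fc fs.
- exact: hom_comp.
- by apply: (bounded_hom (hom_comp ih hh) (C := 1)) => x /=; rewrite mul1r -iN hn.
- move=> c fc0 /=; apply/hk => -[c1 c2].
  have -> : t (c1, c2) (i c) = c1 ** c ** c2 by apply: ii; rewrite ht !(homM ih).
  by rewrite !(homM fh) fc0 ba_mul0r ba_mul0l.
rewrite /= in phif.
have phi_inj : injective phi.
  apply: (hom_inj phih) => b; have [c <-] := fs b; rewrite phif => /hk Nc.
  apply: (cq_free_nil (proj2 sB)) => b1 b2.
  have [c1 <-] := fs b1; have [c2 <-] := fs b2.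
  have := Nc (c1, c2); have -> : t (c1, c2) (i c) = c1 ** c ** c2.
    by apply: ii; rewrite ht !(homM ih).
  by rewrite !(homM fh).
exists E, h; split=> //; last first.
  have [c0 fc0] := fs b0; exists c0 => hc0; apply: b0n; apply: phi_inj.
  by rewrite -fc0 phif hc0 (hom0 phih).
have [K2 K20 hK2] := open_mapping hh hc hs.
(* [K] is paid for lifting each of [b] and [b'], [K2] for lifting [e], and [L] for applying [f] to
   the lifted sandwich. *)
apply: (@semisimple_sandwich B E phi (L * K * K * K2)) => //.
- by rewrite !mulr_gt0.
- move=> b b' e; have [a <- na] := hK2 e.
  have [c <- nc] := hK b; have [c' <- nc'] := hK b'.
  exists (f (t (c, c') a)); first by rewrite !phif ht !(homM hh).
  rewrite (le_trans (hL _)) //.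
  have -> : L * K * K * K2 * rn (f c) * rn (f c') * rn (h a) =
    L * (K * rn (f c) * (K * rn (f c')) * (K2 * rn (h a))) by ring.
  rewrite ler_pM2l // (le_trans (tn _ _)) //=.
  by apply: ler_pM => //; rewrite ?mulr_ge0 //; apply: ler_pM.
- move=> e he; have [a ea] := hs e; rewrite -ea; apply/hk => -[c c'].
  apply: phi_inj; rewrite phif ht !(homM hh) (hom0 phih) ea /=.
  by rewrite -!phif he.
Qed.

End Transfer.

(** * The comparison radical *)

Section Radical.
Variable R : realType.
Implicit Types A B C D : banach_algebra R.

Definition semisimple_radical : radical_map R := fun A => [set x | forall B (f : A -> B),
  is_hom f -> continuous f -> (forall y, exists x, f x = y) -> semisimple B -> f x = 0].
Arguments semisimple_radical : clear implicits.

(** The quotient [D] injects onto [f(J)], an ideal of [B] because [f] is onto; lifting by open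
    mappings bounds the action of [B] in the quotient norm, as [semisimple_ideal_range] requires. *)
Lemma semisimple_restrict A B C (J : set A) (i : C -> A) (f : A -> B) :
  closed_ideal J -> embeds_onto i J ->
  is_hom f -> continuous f -> (forall y, exists x, f x = y) -> semisimple B ->
  exists D (q : C -> D), quotient_map q [set c | f (i c) = 0] /\ semisimple D.
Proof.
move=> [idJ _] /embedsP[ih iN ii iJ Ji] fh fc fs sB.
have [_ _ _ _ [JMl JMr]] := idealP idJ.
have fih : is_hom (f \o i) by exact: hom_comp.
have [L L0 hL] := hom_bounded fh fc.
have fic : continuous (f \o i).
  by apply: (bounded_hom fih (C := L)) => x; rewrite -iN /= hL.
have cN := closed_ideal_preimage fih fic (closed_ideal0 B).
have [D [q qq]] := quotient_exists cN.
have [qh qc qs qk qn] := quotient_mapP qq.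
exists D, q; split=> //.
have [|g [gh gc gq]] := @hom_factor R _ _ _ q (f \o i) qh qc qs fih fic.
  by move=> x /qk.
have gi : injective g.
  by apply: (hom_inj gh) => d; have [c <-] := qs d; rewrite gq => /qk.
have [K1 K10 hK1] := open_mapping fh fc fs.
have [K2 K20 hK2] := open_mapping qh qc qs.
apply: (@semisimple_ideal_range R D B g (K2 * K1) gh gc gi) => //.
- by rewrite mulr_gt0.
- move=> b d; have [c <-] := qs d; have [a <-] := fs b.
  have [c' ic'] := Ji _ (JMl a (i c) I (iJ c)).
  by exists (q c'); rewrite !gq /= ic' (homM fh).
- move=> d b; have [c <- nc] := hK2 d; have [a <- na] := hK1 b.
  have [c' ic'] := Ji _ (JMr a (i c) I (iJ c)).
  exists (q c'); first by rewrite !gq /= ic' (homM fh).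
  have N0 : f (i 0) = 0 by rewrite (hom0 ih) (hom0 fh).
  rewrite (le_trans (qn _ N0)) //.
  rewrite -iN ic' (le_trans (rnM _ _)) // iN.
  have -> : K2 * K1 * rn (q c) * rn (f a) = K2 * rn (q c) * (K1 * rn (f a)) by ring.
  exact: ler_pM.
Qed.

Lemma semisimple_radical_closed_ideal A : closed_ideal (semisimple_radical A).
Proof.
split; last first.
  apply/closed_rnP => x hx B f fh fc fs sB; have [L L0 hL] := hom_bounded fh fc.
  apply: rn_le0 => e e0; have [|y Ny xy] := hx (e / L); first by rewrite divr_gt0.
  rewrite -[f x]subr0 -(Ny B f fh fc fs sB) -(homB fh) (le_trans (hL _)) //.
  by rewrite mulrC -ler_pdivlMr // ltW.
apply: idealE.
- by move=> B f fh *; apply: hom0.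
- by move=> x y Nx Ny B f fh fc fs sB; rewrite (homD fh) Nx // Ny // addr0.
- by move=> t x Nx B f fh fc fs sB; rewrite (homZ fh) Nx // scaler0.
- move=> a x Nx; split=> B f fh fc fs sB; rewrite (homM fh) Nx //.
    exact: ba_mul0r.
  exact: ba_mul0l.
Qed.

Lemma semisimple_radical_topological : topological_radical semisimple_radical.
Proof.
split; first exact: semisimple_radical_closed_ideal.
split; [|split; [|split]].
- move=> A B f fh fc fs _ [x Nx <-] D g gh gc gs sD.
  apply: (Nx D (g \o f)) => //; first exact: hom_comp.
    by move=> z; apply: continuous_comp; [apply: fc|apply: gc].
  by move=> y; have [b <-] := gs y; have [a <-] := fs b; exists a.
- move=> A B q qq; have [qh qc qs qk qn] := quotient_mapP qq.
  apply/seteqP; split=> [y Ny|_ ->]; last first.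
    by case: (idealP (proj1 (semisimple_radical_closed_ideal B))).
  have [x xy] := qs y; rewrite -xy in Ny *.
  apply/qk => D f fh fc fs sD.
  have [|g [gh gc gq]] := @hom_factor R _ _ _ q f qh qc qs fh fc.
    by move=> z /qk; apply.
  rewrite -gq; apply: Ny => // z; have [a <-] := fs z.
  by exists (q a).
- move=> A C i hi; have [ih iN ii iJ Ji] := embedsP hi.
  apply/seteqP; split=> [_ [c _ <-] //|x Nx]; have [c ic] := Ji _ Nx.
  (* Were [f c] non-zero, the extension would give a semisimple image of [A] in which the radical of
     [A] does not vanish. *)
  exists c => // B f fh fc fs sB; apply: contrapT => fn.
  have [|E [h [hh hc hs sE [c' nc']]]] :=
    semisimple_quotient_extend (semisimple_radical_closed_ideal A) hi fh fc fs sB; first by exists (f c).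
  by apply: nc'; apply: iJ.
- move=> A C J i cJ hi; have [ih iN ii iJ Ji] := embedsP hi.
  have [_ _ _ _ [JMl JMr]] := idealP (proj1 cJ).
  have [_ N0 ND NZ _] := idealP (proj1 (semisimple_radical_closed_ideal C)).
  split; last first.
    move=> _ [c Nc <-] B f fh fc fs sB.
    have [D [q [qq sD]]] := semisimple_restrict cJ hi fh fc fs sB.
    have [qh qc qs qk _] := quotient_mapP qq.
    by apply/qk; apply: Nc.
  apply: idealE.
  + by exists 0; rewrite ?(hom0 ih).
  + move=> _ _ [x Nx <-] [y Ny <-].
    by exists (x + y); [apply: ND|rewrite (homD ih)].
  + move=> t _ [x Nx <-].
    by exists (t *: x); [apply: NZ|rewrite (homZ ih)].
  (* Stability under [A], not only under [C]: in a sandwich of [a x] by elements of [J], the factor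
     [a] joins its neighbour and stays in [J], so all sandwiches of [f c] vanish. *)
  + move=> a _ [x Nx <-]; split.
      have [c ic] := Ji _ (JMl a _ I (iJ x)).
      exists c => // B f fh fc fs sB; apply: (cq_free_nil (proj2 sB)) => b b'.
      have [u <-] := fs b; have [u' <-] := fs b'.
      have [v iv] := Ji _ (JMr a _ I (iJ u)).
      rewrite -!(homM fh); have -> : u ** c ** u' = v ** x ** u'.
        by apply: ii; rewrite !(homM ih) ic iv !ba_mulA.
      by rewrite !(homM fh) (Nx B f) // ba_mul0r ba_mul0l.
    have [c ic] := Ji _ (JMr a _ I (iJ x)).
    exists c => // B f fh fc fs sB; apply: (cq_free_nil (proj2 sB)) => b b'.
    have [u <-] := fs b; have [u' <-] := fs b'.
    have [v iv] := Ji _ (JMl a _ I (iJ u')).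
    rewrite -!(homM fh); have -> : u ** c ** u' = u ** x ** v.
      by apply: ii; rewrite !(homM ih) ic iv !ba_mulA.
    by rewrite !(homM fh) (Nx B f) // ba_mul0r ba_mul0l.
Qed.

Lemma cq_embedding A C (J : set A) (i : C -> A) : embeds_onto i J -> cq_set J -> cq_set [set: C].
Proof.
move=> /embedsP[ih iN ii iJ Ji] cJ M _ pM.
have piM : tot_bounded (i @` M).
  apply: (@tot_bounded_map _ _ _ _ _ (fun x y => y = i x) 1 pM) => [_ [x Mx <-]|]; first by exists x.
  by move=> x _ x' _ _ _ -> ->; rewrite -(homB ih) iN mul1r.
have iMJ : i @` M `<=` J by move=> _ [x _ <-].
move=> d d0; have [K K0 hK] := cJ _ iMJ piM d d0; exists K => // u s hs.
rewrite -iN (hom_foldl ih) -(size_map i) -(iN u); apply: hK.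
by move=> _ /mapP[x /hs Mx ->]; exists x.
Qed.

(** The quotient [D] of [P] by the kernel of [f] is compactly quasinilpotent as an image of [P], and
    semisimple by restriction; hence it is 0. *)
Lemma semisimple_radical_cq A (P : set A) : closed_ideal P -> cq_set P -> P `<=` semisimple_radical A.
Proof.
move=> cP cqP x Px B f fh fc fs sB.
have [C [i hi]] := subalgebra_exists cP.
have [D [q [qq [_ fD]]]] := semisimple_restrict cP hi fh fc fs sB.
have [qh qc qs qk _] := quotient_mapP qq.
have cD := cq_image qh qc qs (cq_embedding hi cqP).
have [_ _ _ _ Ji] := embedsP hi; have [c <-] := Ji x Px.
apply/qk; apply: (fD setT) => //.
Qed.

(** If [f] did not vanish on [P], hypocompactness would give a non-zero compact element of [P]
    modulo the kernel [K] of [f] on [P]; but this quotient is the semisimple [D]. *)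
Lemma semisimple_radical_hypocompact A (P : set A) :
  closed_ideal P -> hypocompact_ideal P -> P `<=` semisimple_radical A.
Proof.
move=> cP hP x Px B f fh fc fs sB.
have [C [i hi]] := subalgebra_exists cP.
have [D [q [qq [cD _]]]] := semisimple_restrict cP hi fh fc fs sB.
have [qh qc qs qk qn] := quotient_mapP qq.
have [ih iN ii iJ Ji] := embedsP hi.
have [L L0 hL] := hom_bounded fh fc.
pose K : set A := P `&` f @^-1` [set 0].
have cK : closed_ideal_in P K.
  have [idN cN] := closed_ideal_preimage fh fc (closed_ideal0 B).
  have [_ P0 PD PZ [PMl PMr]] := idealP (proj1 cP).
  have [_ N0 ND NZ [NMl NMr]] := idealP idN.
  split; last by apply: closedI => //; case: cP.
  split; first by move=> y [].
  split.
    split; first by [].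
    split=> [y z [? ?] [? ?]|t y [? ?]]; split; by [apply: PD|apply: ND|apply: PZ|apply: NZ].
  by move=> a y _ [? ?]; split; split; by [apply: PMl|apply: PMr|apply: NMl|apply: NMr].
apply: contrapT => fx.
have [|a [Pa [nKa [_ pa]]]] := hP K cK; first by exists x; split=> // -[].
have [c ic] := Ji a Pa.
suff /cD/qk qc0 : compact_elt (q c) by apply: nKa; split; rewrite // -ic.
have ext y : exists c', P y -> i c' = y.
  by have [/Ji[c' <-]|] := pselect (P y); [exists c'|exists 0].
have [tau htau] := choice ext.
apply: net_tot_bounded => e e0; have [|F [FP hF]] := pa e%:C%C; first by rewrite ltcR.
exists (map (q \o tau) F) => _ [y /= y1 <-].
have [c' qc'] := qs y; rewrite -qc' in y1 *.
(* The slack [1 - rn (q c')] turns norm below 1 in [D] into distance below 1 from the kernel, as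
   [compact_elt_mod] asks. *)
have [k [k0 kn]] : exists k, f (i k) = 0 /\ rn (c' - k) < 1.
  have [_ [_ [_ [_ h]]]] := qq.
  have [|k k0 kn] := h c' (1 - rn (q c'))%:C%C; first by rewrite ltcR subr_gt0.
  by exists k; split=> //; rewrite !normE -rmorphD ltcR /= addrCA subrr addr0 in kn.
have [|y' [Fy' [k' [Pk' fk'] lt]]] := hF (a ** i c' ** a).
  exists (i c') => //; split; first exact: iJ.
  by exists (i k); [split|rewrite -(homB ih) normE iN ltcR].
rewrite norm_lt in lt; exists (q (tau y')); first by apply: (map_f (q \o tau)).
apply: le_lt_trans lt.
have ky : i (c ** c' ** c - tau y' - tau k') = a ** i c' ** a - y' - k'.
  by rewrite !(homB ih) !(homM ih) ic !htau //; apply: FP.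
rewrite -ky iN; have <- : q (c ** c' ** c - tau y' - tau k') = q c ** q c' ** q c - q (tau y').
  have qk' : q (tau k') = 0 by apply/qk; rewrite /= htau.
  by rewrite !(homB qh) qk' subr0 !(homM qh).
by apply: qn; rewrite /= (hom0 ih) (hom0 fh).
Qed.

(* Multiplication by an optional factor, so that b a c covers a, b a and a c. *)
Let lmul A (b : option A) (x : A) := if b is Some b then b ** x else x.
Let rmul A (x : A) (c : option A) := if c is Some c then x ** c else x.

(** (b a c) x (b a c) = b (a (c x b) a) c, where c x b stays bounded over the unit ball. *)
Lemma compact_elt_mul A (a : A) b c : compact_elt a -> compact_elt (lmul b (rmul a c)).
Proof.
move=> ca; pose n (o : option A) := if o is Some x then rn x else 1.
have n0 o : 0 <= n o by case: o => /=.
have ln o x : rn (lmul o x) <= n o * rn x by case: o => [y|] /=; rewrite ?rnM ?mul1r.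
have rnn o x : rn (rmul x o) <= n o * rn x.
  by case: o => [y|] /=; rewrite ?mul1r // mulrC rnM.
pose T := n c * n b + 1; have T0 : 0 < T by rewrite ltr_pwDr // mulr_ge0.
apply: (@tot_bounded_map _ _ _ _ _ (fun w z => z = lmul b (rmul w c)) (n b * n c)
  (compact_elt_ball T0 ca)).
  move=> _ [x /= x1 <-]; exists (a ** lmul c (rmul x b) ** a).
    exists (lmul c (rmul x b)) => //=; rewrite (le_lt_trans (ln _ _)) //.
    rewrite /T (@le_lt_trans _ _ (n c * n b)) ?ltrDl // ler_wpM2l //.
    by rewrite (le_trans (rnn _ _)) // ler_piMr // ltW.
  by case: b c {T T0} => [b|] [c|]; rewrite /= ?ba_mulA.
move=> w _ w' _ _ _ -> ->.
have -> : lmul b (rmul w c) - lmul b (rmul w' c) = lmul b (rmul (w - w') c).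
  by case: b c {T T0} => [b|] [c|]; rewrite /= ?ba_mulBl ?ba_mulBr.
by rewrite (le_trans (ln _ _)) // -mulrA ler_wpM2l.
Qed.

(** The closed ideal generated by [a] works. A closed ideal [K] missing part of it misses some
    generator b a c, and this generator is compact in [A], hence also modulo [K]. *)
Lemma compact_elt_hypocompact A (a : A) : compact_elt a ->
  exists I : set A, [/\ closed_ideal I, hypocompact_ideal I & I a].
Proof.
move=> ca; pose G : set A := [set y | exists b c, y = lmul b (rmul a c)].
pose good (V : set A) := [/\ is_subspace V, closed V & G `<=` V].
(* As an intersection of closed subspaces, [I] is shown stable under multiplication by pulling each
   [V] back along left and right multiplication by [b]. *)
pose I : set A := [set x | forall V, good V -> V x].
have GI : G `<=` I by move=> x Gx V [_ _]; apply.
have idI : ideal_in setT I.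
  apply: idealE.
  - by move=> V [[]].
  - by move=> x y Ix Iy V gV; case: (gV) => -[_ [VD _]] _ _; apply: VD; [apply: Ix|apply: Iy].
  - by move=> t x Ix V gV; case: (gV) => -[_ [_ VZ]] _ _; apply: VZ; apply: Ix.
  - move=> b x Ix; have b1 : 0 < rn b + 1 by rewrite ltr_pwDr.
    split=> V [[V0 [VD VZ]] cV GV].
      apply: (Ix [set x | V (b ** x)]); split=> /=.
      + split; first by rewrite /= ba_mul0r.
        by split=> [y z|t y] /=; rewrite ?ba_mulDr ?ba_mulZr; [apply: VD|apply: VZ].
      + apply/closed_rnP => y hy /=; apply: (proj1 (closed_rnP V) cV) => e e0.
        have [|z Vz yz] := hy (e / (rn b + 1)); first by rewrite divr_gt0.
        exists (b ** z) => //; rewrite -ba_mulBr (le_lt_trans (rnM _ _)) //.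
        rewrite ltr_pdivlMr // in yz; apply: le_lt_trans yz.
        by rewrite mulrC ler_wpM2l // lerDl.
      + move=> _ [[b'|] [c ->]] /=; apply: GV; last by exists (Some b), c.
        by exists (Some (b ** b')), c; rewrite /= ba_mulA.
    apply: (Ix [set x | V (x ** b)]); split=> /=.
    + split; first by rewrite /= ba_mul0l.
      by split=> [y z|t y] /=; rewrite ?ba_mulDl ?ba_mulZl; [apply: VD|apply: VZ].
    + apply/closed_rnP => y hy /=; apply: (proj1 (closed_rnP V) cV) => e e0.
      have [|z Vz yz] := hy (e / (rn b + 1)); first by rewrite divr_gt0.
      exists (z ** b) => //; rewrite -ba_mulBl (le_lt_trans (rnM _ _)) //.
      rewrite ltr_pdivlMr // in yz; apply: le_lt_trans yz.
      by rewrite ler_wpM2l // lerDl.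
    + move=> _ [b' [[c|] ->]] /=; apply: GV.
        by exists b', (Some (c ** b)); case: b' => [b'|] /=; rewrite ?ba_mulA.
      by exists b', (Some b); case: b' => [b'|] /=; rewrite ?ba_mulA.
have cI : closed I.
  apply/closed_rnP => x hx V gV; case: (gV) => _ cV _.
  apply: (proj1 (closed_rnP V) cV) => e /hx[y Iy xy].
  by exists y => //; apply: Iy.
exists I; split=> //; last by apply: GI; exists None, None.
have [_ _ _ _ [IMl IMr]] := idealP idI.
move=> K [idK cK] [x [Ix nKx]].
have [_ K0 KD KZ [KMl KMr]] := idealP idK.
have [y [Gy nKy]] : exists y, G y /\ ~ K y.
  apply: contrapT => nG; apply: nKx; apply: Ix; split=> //.
  by move=> y Gy; apply: contrapT => nKy; apply: nG; exists y.
exists y; split; first exact: GI.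
split=> //; split; first exact: GI.
have cy : compact_elt y by case: Gy => b [c ->]; apply: compact_elt_mul.
move=> _ /gt0_realE[e e0 ->]; have [F [FS hF]] := tot_bounded_net cy e0.
exists F; split=> [f /FS[u _ <-]|_ [u [Iu [k Kk uk]] <-]].
  by apply: IMl => //; apply: GI.
rewrite (_ : 1 = (1 : R)%:C%C) // norm_lt in uk.
have [|f fF lt] := hF (y ** (u - k) ** y); first by exists (u - k).
exists f; split=> //; exists (y ** k ** y).
  by apply: KMr; [apply: GI|apply: KMl => //; apply: GI].
by rewrite norm_lt addrAC -ba_mulBl -ba_mulBr.
Qed.

End Radical.

Theorem theorem4p7 (R : realType) (Rhc Rcq T : radical_map R) :
  is_Rhc Rhc -> is_Rcq Rcq -> is_radical_join Rhc Rcq T -> hereditary T.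
Proof.
move=> hRhc hRcq [topT [hcT [cqT minT]]].
have T_ss : radical_le T (@semisimple_radical R).
  apply: minT; first exact: semisimple_radical_topological.
    by move=> A; have [cP [hP _]] := hRhc A; apply: semisimple_radical_hypocompact.
  by move=> A; have [cP [/cqE hP _]] := hRcq A; apply: semisimple_radical_cq.
have [T1 [_ [T3 [T4 T5]]]] := topT.
have zero_ss (B : banach_algebra R) : T B = [set 0] -> semisimple B.
  move=> TB0; split=> [a /compact_elt_hypocompact[I [cI hI Ia]]|I cI /cqE qI x Ix].
    have [_ [_ /(_ I cI hI a Ia) /hcT]] := hRhc B.
    by rewrite TB0.
  have [_ [_ /(_ I cI qI x Ix) /cqT]] := hRcq B.
  by rewrite TB0.
move=> A C J i cJ hi; have [ih iN ii iJ Ji] := embedsP hi.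
apply/seteqP; split.
  move=> x Tx; split; first by case: Tx => c _ <-.
  by case: (T5 A C J i cJ hi) => _; apply.
move=> x [Jx Tx].
have [CI [k hk]] := subalgebra_exists (T1 A).
have [kh kN ki kT Tk] := embedsP hk.
have kc : continuous k by apply: (bounded_hom kh (C := 1)) => u; rewrite mul1r kN.
have ic : continuous i by apply: (bounded_hom ih (C := 1)) => u; rewrite mul1r iN.
(* [CI] is [T A] as an algebra, and idempotence makes [T] everything on it. *)
have TCI u : T CI u.
  have : (k @` T CI) (k u) by rewrite (T4 _ _ _ hk); apply: kT.
  by case=> v Tv /ki <-.
(* The intersection of [J] and [T A], taken as an ideal of [CI] because the extension lemma is to be
   applied inside [CI]. *)
have cK : closed_ideal (k @^-1` J) by apply: closed_ideal_preimage.
have [CK [l hl]] := subalgebra_exists cK.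
have [lh lN li lK Kl] := embedsP hl.
have TCK v : T CK v.
  have [B [q qq]] := quotient_exists (T1 CK).
  have [qh qc qs qk _] := quotient_mapP qq.
  have sB := zero_ss B (T3 _ _ _ qq).
  apply/qk; apply: contrapT => qv.
  have [|E [h [hh hc hs sE [w nw]]]] := semisimple_quotient_extend cK hl qh qc qs sB.
    by exists (q v).
  by apply: nw; apply: (T_ss _ _ (TCI (l w))).
(* The same algebra [CK] is now embedded in [C], as the ideal of those [c] with [i c] in [T A]; the
   ideal axiom [T5] then puts [T CK], which is all of [CK], inside [T C]. *)
have ext v : exists c, i c = k (l v) by apply: Ji; apply: lK.
have [j hj] := choice ext.
have hjC : embeds_onto j (i @^-1` T A).
  split; [split; [|split]|split].
  - by move=> u v; apply: ii; rewrite (homD ih) !hj (homD lh) (homD kh).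
  - by move=> t u; apply: ii; rewrite (homZ ih) !hj (homZ lh) (homZ kh).
  - by move=> u v; apply: ii; rewrite (homM ih) !hj (homM lh) (homM kh).
  - by move=> u; rewrite !normE -iN hj kN lN.
  - apply/seteqP; split=> [_ [v _ <-]|c /= Tc]; first by rewrite /= hj; apply: kT.
    have [u ku] := Tk _ Tc; have [|v lv] := Kl u; first by rewrite /= ku; apply: iJ.
    by exists v => //; apply: ii; rewrite hj lv ku.
have cTC : closed_ideal (i @^-1` T A) by apply: closed_ideal_preimage.
have [_ TCsub] := T5 C CK _ j cTC hjC.
have [c cx] := Ji x Jx; exists c => //; apply: TCsub.
have [_ _ _ _ Tj] := embedsP hjC.
have [v jv] := Tj c (eq_ind_r (T A) Tx cx).
by exists v.
Qed.
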